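(* Let $G$ be a plane network with root vertex $\rho$, and let $\mathcal S_\rho$ be the rectangle tiling of $G$ in the cylinder $\mathbb R/\eta\mathbb Z\times[0,1]$. Let $\langle X_n\rangle_{n\geq 0}$ be the random walk on $G$ started at $\rho$. Suppose that, almost surely, $\theta(X_n)$ converges to a point of $\mathbb R/\eta\mathbb Z$ and $\mathrm{length}(I(X_n))\to 0$ as $n\to\infty$. Then for every bounded harmonic function $h$ on $G$ there exists a bounded Borel function $f:\mathbb R/\eta\mathbb Z\to\mathbb R$ such that \[ h(v)=E_v\Big[f\Big(\lim_{n\to\infty}\theta(X_n)\Big)\Big] \quad\text{for every } v\in V,\] where $E_v$ is the expectation for the random walk started at $v$.
   Context: A network $(G,c)$ is a connected, locally finite graph $G=(V,E)$ (self-loops and multiple edges allowed) with conductances $c:E\to(0,\infty)$; $c(v)$ is the sum of conductances of edges at $v$, $c(u,v)$ the sum of conductances of edges joining $u$ and $v$, and the random walk has transition probabilities $p(u,v)=c(u,v)/c(u)$. $P_v,E_v$ denote law and expectation of the walk started at $v$. A function $h:V\to\mathbb R$ is harmonic if $h(u)=\sum_v p(u,v)h(v)$ for all $u$. Let $\mathbb G$ be the metric graph obtained from $V$ and one copy $[0,1]$ per edge glued at the endpoints. An embedding of $G$ into a surface $S$ is a continuous injective map $\mathbb G\to S$; a plane network is a network together with an embedding into $\mathbb R^2$. Rectangle tiling: fix a root $\rho\in V$; let $y(v)=P_v(\text{the walk never visits }\rho)$ and $\eta=\sum_{u\sim\rho}c(\rho,u)y(u)$. The rectangle tiling (constructed by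 Benjamini and Schramm for transient, uniquely absorbing plane networks) is a collection $\mathcal S_\rho=\{S(e):e\in E\}$ such that: (1) for each oriented edge $e$ from $e^-$ to $e^+$ with $y(e^+)\geq y(e^-)$, $S(e)=I(e)\times[y(e^-),y(e^+)]\subseteq\mathbb R/\eta\mathbb Z\times[0,1)$ where $I(e)\subseteq\mathbb R/\eta\mathbb Z$ is an interval of length $c(e)(y(e^+)-y(e^-))$, and $I(e)=I(-e)$, $S(e)=S(-e)$ otherwise; (2) the interiors of the $S(e)$ are disjoint and their union is $\mathbb R/\eta\mathbb Z\times[0,1)$; (3) for each vertex $v$, $I(v):=\bigcup_{e^-=v}I(e)$ is an interval and equals $\bigcup_{e^+=v}I(e)$; (4) for a.e. $\theta$ and every $t\in[0,1)$, the segment $\{\theta\}\times[0,t]$ meets only finitely many rectangles; (5) the interiors of vertical sides of $S(e_1),S(e_2)$ intersect only if $e_1,e_2$ lie on the boundary of a common face. For each $v$, $\theta(v)$ is a point chosen arbitrarily in $I(v)$. *)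

(* Defs.v *)
From HB Require Import structures.
From mathcomp Require Import all_boot all_order all_algebra.
From mathcomp Require Import all_classical all_reals all_analysis.
Set Implicit Arguments.
Unset Strict Implicit.
Unset Printing Implicit Defensive.
Import Order.TTheory GRing.Theory Num.Theory numFieldNormedType.Exports.
Local Open Scope classical_set_scope.
Local Open Scope ring_scope.

Section Network.
Variables (R : realType) (V E : choiceType).
(* each (undirected) edge e has a fixed reference orientation src e -> tgt e;
   loops (src e = tgt e) and multiple edges are allowed *)
Variables (src tgt : E -> V) (c : E -> R).

Definition incident (v : V) : set E := [set e | src e = v \/ tgt e = v].
Definition joins (e : E) (u v : V) : Prop :=
  (src e = u /\ tgt e = v) \/ (src e = v /\ tgt e = u).
Definition nbrs (u : V) : set V := [set v | exists e, joins e u v].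
Definition cond_pair (u v : V) : R := \sum_(e \in [set e | joins e u v]) c e.
Definition cond_vert (u : V) : R := \sum_(e \in incident u) c e.
Definition trans_prob (u v : V) : R := cond_pair u v / cond_vert u.

Definition is_harmonic (h : V -> R) : Prop :=
  forall u, h u = \sum_(v \in nbrs u) trans_prob u v * h v.

Definition graph_connected : Prop :=
  forall u v : V, exists (n : nat) (x : nat -> V),
    [/\ x 0%N = u, x n = v & forall i, (i < n)%N -> nbrs (x i) (x i.+1)].

Definition is_network : Prop :=
  [/\ forall e, 0 < c e, forall v, finite_set (incident v) & graph_connected].

(* Embedding of the metric graph into R^2: vertex positions phi, and for each
   edge a path gam e : [0,1] -> R^2 from phi (src e) to phi (tgt e); the
   induced map on the metric graph is continuous and injective. *)
Variables (phi : V -> R * R) (gam : E -> R -> R * R).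

Definition plane_embedding : Prop :=
  [/\ forall e, {within `[0, 1], continuous gam e},
      forall e, gam e 0 = phi (src e) /\ gam e 1 = phi (tgt e),
      injective phi,
      forall e s v, 0 < s < 1 -> gam e s <> phi v &
      forall e1 e2 s1 s2, 0 < s1 < 1 -> 0 < s2 < 1 ->
        gam e1 s1 = gam e2 s2 -> e1 = e2 /\ s1 = s2].

Definition emb_image : set (R * R) :=
  range phi `|` \bigcup_(e in [set: E]) (gam e @` `[0, 1]).

Definition face (F : set (R * R)) : Prop :=
  exists p, ~ emb_image p /\ F = connected_component (~` emb_image) p.

Definition on_face_boundary (e : E) (F : set (R * R)) : Prop :=
  gam e @` `[0, 1] `<=` closure F.

Variables (d : measure_display) (Om : measurableType d)
  (P : V -> probability Om R) (X : nat -> Om -> V).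

Definition is_random_walk : Prop :=
  (forall n v, measurable (X n @^-1` [set v])) /\
  forall (v : V) (n : nat) (x : nat -> V),
    P v [set w | forall i, (i <= n)%N -> X i w = x i] =
    (((x 0%N == v)%:R * \prod_(i < n) trans_prob (x i) (x i.+1)) : R)%:E.

Variable rho : V.

Definition yv (v : V) : R := fine (P v [set w | forall n, X n w <> rho]).

Definition eta_cyl : R := \sum_(u \in nbrs rho) cond_pair rho u * yv u.

(* points of R / eta_cyl Z are represented by their lifts in R *)
Definition circ_conv (s : nat -> R) (t : R) : Prop :=
  exists k : nat -> int, (fun n => s n + (k n)%:~R * eta_cyl) @ \oo --> t.

(* closed arc of R/etaZ starting at b of length l, lifted to R *)
Definition arc (b l : R) : set R :=
  [set x | exists k : int, b <= x + k%:~R * eta_cyl <= b + l].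

Definition is_arc (S : set R) : Prop :=
  exists b l, 0 <= l <= eta_cyl /\ S = arc b l.

Definition ylo (e : E) : R := Num.min (yv (src e)) (yv (tgt e)).
Definition yhi (e : E) : R := Num.max (yv (src e)) (yv (tgt e)).
Definition len (e : E) : R := c e * (yhi e - ylo e).

Variable a : E -> R.

Definition Iedge (e : E) : set R := arc (a e) (len e).

Definition rect (e : E) : set (R * R) :=
  [set p | Iedge e p.1 /\ ylo e <= p.2 <= yhi e].

(* edges e with e^- = v, resp. e^+ = v (for some admissible orientation) *)
Definition out_edges (v : V) : set E :=
  [set e | (src e = v /\ yv (src e) <= yv (tgt e)) \/
           (tgt e = v /\ yv (tgt e) <= yv (src e))].
Definition in_edges (v : V) : set E :=
  [set e | (tgt e = v /\ yv (src e) <= yv (tgt e)) \/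
           (src e = v /\ yv (tgt e) <= yv (src e))].

Definition Ivert (v : V) : set R := \bigcup_(e in out_edges v) Iedge e.

Definition Ilength (v : V) : \bar R :=
  lebesgue_measure (Ivert v `&` `[0, eta_cyl[).

Definition vside (e : E) : set (R * R) :=
  [set p | (exists k : int, p.1 + k%:~R * eta_cyl = a e \/
                            p.1 + k%:~R * eta_cyl = a e + len e)
           /\ ylo e < p.2 < yhi e].

Definition rect_tiling : Prop :=
  [/\ (* (1) *) forall e, len e <= eta_cyl,
      (* (2) *) (forall e1 e2, e1 <> e2 ->
                   interior (rect e1) `&` interior (rect e2) = set0)
                /\ \bigcup_(e in [set: E]) rect e = [set p | 0 <= p.2 < 1],
      (* (3) *) forall v, is_arc (Ivert v) /\
                   (v <> rho -> Ivert v = \bigcup_(e in in_edges v) Iedge e),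
      (* (4) *) {ae lebesgue_measure, forall x : R, forall t, 0 <= t < 1 ->
                   finite_set [set e | exists s, 0 <= s <= t /\ rect e (x, s)]} &
      (* (5) *) forall e1 e2, (exists p, vside e1 p /\ vside e2 p) ->
                   exists F, [/\ face F, on_face_boundary e1 F &
                                 on_face_boundary e2 F]].

End Network.

(* Main.v *)
(** Almost surely the angles of the walk converge to some [L] and [h(X_n)] converges to
    some [H] with [h(v) = E_v H], so [H] has to be recognized as a function of [L].
    For a rational [q] and a height [s < 1] consider the rays along which [h <= q] and
    which stay above [s], and the open intervals spanned by the ends of two such rays
    from a common vertex, in the universal cover of the cylinder. If [H > q], then the
    walk meets no such ray once [s] is large, and by planarity [L] lies in none of these
    intervals. If [H < q], then a tail of the walk is such a ray for every [s], so [L]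
    lies in one of the intervals unless it is an extreme end; there are countably many
    of these and [L] has no atoms. Hence [{H <= q}] is, up to null sets, the event that
    [L] lies in a Borel set.

    Planarity enters through the parity of the number of steps of a lifted path that
    cross a horizontal half-line. By a discrete Green formula this also counts the
    crossings of a vertical ray, so it is constant along every path disjoint from the
    first one. There are no atoms because Brownian motion on the metric graph first hits
    height [t] at a uniform angle; in the discrete setting, killing the walk below
    height [t] at a suitable rate shows that it stays eventually above an arc of length
    [l] with probability at most [l / eta]. *)

Require Import Defs.
From HB Require Import structures.
From mathcomp Require Import all_boot all_order all_algebra.
From mathcomp Require Import all_classical all_reals all_analysis.
From mathcomp Require Import measurable_realfun ring lra.
Import Order.TTheory GRing.Theory Num.Theory numFieldNormedType.Exports.
Set Implicit Arguments.
Unset Strict Implicit.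
Unset Printing Implicit Defensive.
Local Open Scope classical_set_scope.
Local Open Scope ring_scope.

(** * Networks *)

(** The hypothesis concerns the walk from [rho] only, the conclusion every start. The event that the
    angles converge and [h] tends to the boundary function at their limit is closed under the shift,
    so connectedness carries it to all vertices. Rays are taken in pairs from one vertex because a
    pair forms a bi-infinite path, which separates; the lower bound on their heights keeps the root,
    where the walk starts, on a known side of it. The ends of a pair are compared within one lift of
    the arc of that vertex, since angles are ordered only in the cover. The extreme ends are one
    supremum and one infimum for each vertex, level and rational. The killing rate comes from
    cutting edges at height [t]: the mass of a cut edge is divided between its two ends as Brownian
    motion started at the cut would choose between them, so the graph itself need not be subdivided.
    The Green function of the killed walk is explicit because [t - y] is harmonic off the root and
    vanishes at height [t]. *)

Section Network.
Variables (R : realType) (V E : choiceType) (src tgt : E -> V) (c : E -> R).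
Hypothesis net : is_network src tgt c.

Local Notation cp := (cond_pair src tgt c).
Local Notation cv := (cond_vert src tgt c).
Local Notation p := (trans_prob src tgt c).
Local Notation nb := (nbrs src tgt).
Local Notation inc := (incident src tgt).

(** A loop at [u] gives back [u]; for an edge not incident to [u] the value [src e] has no
    meaning. *)
Definition other_end (u : V) (e : E) : V := if src e == u then tgt e else src e.

Lemma joins_sym e u v : joins src tgt e u v -> joins src tgt e v u.
Proof. by case=> -[]; [right|left]. Qed.

Lemma nbrs_sym u v : nb u v -> nb v u.
Proof. by move=> [e] /joins_sym; exists e. Qed.

Lemma joinsE e u v : joins src tgt e u v <-> inc u e /\ other_end u e = v.
Proof.
rewrite /joins /incident /other_end /=; split.
  move=> [[<- <-]|[<- <-]]; first by rewrite eqxx; split => //; left.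
  by split; [right|case: eqP].
case=> -[ue|ue]; case: eqP => [su|nsu] uv; [by left|by []|by left|by right].
Qed.

Lemma cond_pairC u v : cp u v = cp v u.
Proof.
rewrite /cond_pair; congr (\sum_(e \in _) c e); apply/seteqP; split => e /=; exact: joins_sym.
Qed.

Lemma finite_incident u : finite_set (inc u).
Proof. by case: net => _ + _; apply. Qed.

Lemma finite_nbrs u : finite_set (nb u).
Proof.
apply: (sub_finite_set _ (finite_image (other_end u) (finite_incident u))).
by move=> v [e /joinsE[ue <-]]; exists e.
Qed.

Lemma finite_joins u v : finite_set [set e | joins src tgt e u v].
Proof. by apply: sub_finite_set (finite_incident u) => e /joinsE[]. Qed.

Lemma conductance_gt0 e : 0 < c e.
Proof. by case: net. Qed.

Lemma cond_pair_ge0 u v : 0 <= cp u v.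
Proof. by apply: sumr_ge0 => e _; exact/ltW/conductance_gt0. Qed.

Lemma cond_pair_eq0 u v : ~ nb u v -> cp u v = 0.
Proof. by move=> uv; apply: fsbig1 => e euv; case: uv; exists e. Qed.

Lemma cond_pairE u v :
  cp u v = \sum_(e \in inc u) (if other_end u e == v then c e else 0).
Proof.
rewrite (eq_fsbigr (fun e => if e \in [set e | other_end u e = v] then c e else 0)).
  rewrite -fsbig_mkcondr; congr (\sum_(e \in _) c e).
  by apply/seteqP; split => e /joinsE.
by move=> e _; case: eqP => ev; [rewrite mem_set|rewrite memNset].
Qed.

(** Passes from sums over neighbours, natural for the walk, to sums over edges, natural for the
    tiling: parallel edges are grouped by their other end. *)
Lemma sum_nbrsE u (F : V -> R) :
  \sum_(v \in nb u) cp u v * F v = \sum_(e \in inc u) c e * F (other_end u e).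
Proof.
have fi := finite_incident u; have fn := finite_nbrs u.
rewrite (eq_fsbigr (fun v => \sum_(e \in inc u)
    (if other_end u e == v then c e else 0) * F v)); last first.
  by move=> v _; rewrite cond_pairE !fsbig_finite//= big_distrl.
rewrite exchange_fsbig//; apply: eq_fsbigr => e ue.
rewrite fsbig_finite//= (bigD1_seq (other_end u e)) ?fset_uniq//=.
  rewrite eqxx big1 ?addr0// => v; rewrite eq_sym => /negbTE ->.
  by rewrite mul0r.
rewrite in_fset_set// inE; rewrite inE in ue.
by exists e; apply/joinsE.
Qed.

Lemma cond_vertE u : cv u = \sum_(v \in nb u) cp u v.
Proof.
rewrite (eq_fsbigr (fun v => cp u v * 1)); last by move=> ? _; rewrite mulr1.
by rewrite sum_nbrsE; apply: eq_fsbigr => e _; rewrite mulr1.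
Qed.

Hypothesis inc_n0 : forall u, inc u !=set0.

Lemma cond_vert_gt0 u : 0 < cv u.
Proof.
have [e ue] := inc_n0 u.
rewrite /cond_vert (fsbigD1 e)//; last exact: finite_incident.
rewrite ltr_pwDl ?conductance_gt0//.
by apply: sumr_ge0 => i _; exact/ltW/conductance_gt0.
Qed.

Lemma trans_prob_ge0 u v : 0 <= p u v.
Proof. by rewrite divr_ge0 ?cond_pair_ge0// ltW// cond_vert_gt0. Qed.

Lemma trans_prob_gt0 u v : nb u v -> 0 < p u v.
Proof.
move=> [e euv]; rewrite divr_gt0 ?cond_vert_gt0//.
rewrite /cond_pair (fsbigD1 e)//; last exact: finite_joins.
rewrite ltr_pwDl ?conductance_gt0//.
by apply: sumr_ge0 => i _; exact/ltW/conductance_gt0.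
Qed.

Definition walk_step (g : V -> R) (u : V) : R := \sum_(v \in nb u) p u v * g v.

Local Notation step := walk_step.

Lemma stepE g u : step g u = (\sum_(v \in nb u) cp u v * g v) / cv u.
Proof.
have fn := finite_nbrs u.
by rewrite /walk_step !fsbig_finite//= mulr_suml; apply: eq_bigr => v _; rewrite mulrAC.
Qed.

Lemma step_cst k u : step (fun=> k) u = k.
Proof.
have fn := finite_nbrs u.
rewrite stepE fsbig_finite//= -mulr_suml -fsbig_finite//= -cond_vertE mulrAC divff ?mul1r//.
by rewrite gt_eqF// cond_vert_gt0.
Qed.

Lemma stepD g1 g2 u : step (fun v => g1 v + g2 v) u = step g1 u + step g2 u.
Proof.
have fn := finite_nbrs u.
by rewrite /walk_step !fsbig_finite//= -big_split; apply: eq_bigr => v _; rewrite mulrDr.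
Qed.

Lemma stepZ k g u : step (fun v => k * g v) u = k * step g u.
Proof.
have fn := finite_nbrs u.
by rewrite /walk_step !fsbig_finite//= mulr_sumr; apply: eq_bigr => v _; rewrite mulrCA.
Qed.

Lemma stepN g u : step (fun v => - g v) u = - step g u.
Proof. by rewrite -mulN1r -stepZ; apply: eq_fsbigr => v _; rewrite mulN1r. Qed.

Lemma stepB g1 g2 u : step (fun v => g1 v - g2 v) u = step g1 u - step g2 u.
Proof. by rewrite stepD stepN. Qed.

Lemma ler_step g1 g2 u : (forall v, nb u v -> g1 v <= g2 v) -> step g1 u <= step g2 u.
Proof.
have fn := finite_nbrs u.
move=> g12; rewrite /walk_step !fsbig_finite//= big_seq [leRHS]big_seq.
apply: ler_sum => v; rewrite in_fset_set// inE => uv.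
by rewrite ler_wpM2l ?g12// trans_prob_ge0.
Qed.

Lemma eq_step g1 g2 u : (forall v, nb u v -> g1 v = g2 v) -> step g1 u = step g2 u.
Proof. by move=> g12; apply: eq_fsbigr => v; rewrite inE => /g12 ->. Qed.

Lemma step_ge0 g u : (forall v, 0 <= g v) -> 0 <= step g u.
Proof. by move=> g0; rewrite -(step_cst 0 u); apply: ler_step. Qed.

Lemma step_gt0 (g : V -> R) u v : (forall w, 0 <= g w) -> nb u v -> 0 < g v -> 0 < step g u.
Proof.
move=> g0 uv gv; rewrite /walk_step (fsbigD1 v)//; last exact: finite_nbrs.
apply: ltr_pwDl; first by apply: mulr_gt0 => //; exact: trans_prob_gt0.
by apply: fsumr_ge0 => w _; apply: mulr_ge0 => //; exact: trans_prob_ge0.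
Qed.

Lemma step_cvg (F : nat -> V -> R) (G : V -> R) u :
  (forall v, F ^~ v @ \oo --> G v) -> (fun n => step (F n) u) @ \oo --> step G u.
Proof.
have fn := finite_nbrs u.
move=> FG; rewrite /walk_step fsbig_finite//=.
under eq_fun do rewrite fsbig_finite//=.
by apply: cvg_big => [|v _]; [exact: add_continuous|apply: cvgM; [exact: cvg_cst|exact: FG]].
Qed.

(** The variance of one step is nonnegative. Hence squares of harmonic functions are
    submartingales. *)
Lemma step_sqr_ge g u : step g u ^+ 2 <= step (fun v => g v ^+ 2) u.
Proof.
set m := step g u.
have : 0 <= step (fun v => (g v - m) ^+ 2) u by apply: step_ge0 => v; exact: sqr_ge0.
rewrite (_ : step _ u = step (fun v => g v ^+ 2 + (- (2 * m) * g v + m ^+ 2)) u).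
  by rewrite stepD stepD stepZ step_cst -/m; nra.
by apply: eq_step => v _; ring.
Qed.

Definition walk_steps n (g : V -> R) : V -> R := iter n step g.

Local Notation isteps := walk_steps.

Lemma istepsS n g u : isteps n.+1 g u = step (isteps n g) u.
Proof. by []. Qed.

Lemma isteps_add m n g : isteps (m + n) g = isteps m (isteps n g).
Proof. by rewrite /walk_steps iterD. Qed.

Lemma isteps_cst n k u : isteps n (fun=> k) u = k.
Proof.
elim: n u => // n IHn u; rewrite istepsS -[RHS](step_cst k u).
by apply: eq_step => v _; exact: IHn.
Qed.

Lemma istepsD n g1 g2 u :
  isteps n (fun v => g1 v + g2 v) u = isteps n g1 u + isteps n g2 u.
Proof.
elim: n u => // n IHn u; rewrite istepsS (eq_step (fun v _ => IHn v)).
by rewrite stepD.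
Qed.

Lemma istepsZ n k g u : isteps n (fun v => k * g v) u = k * isteps n g u.
Proof.
elim: n u => // n IHn u; rewrite istepsS (eq_step (fun v _ => IHn v)).
by rewrite stepZ.
Qed.

Lemma ler_isteps n g1 g2 u : (forall v, g1 v <= g2 v) -> isteps n g1 u <= isteps n g2 u.
Proof.
by move=> g12; elim: n u => // n IHn u; rewrite !istepsS; apply: ler_step => v _; exact: IHn.
Qed.

Lemma isteps_harmonic n h u : is_harmonic src tgt c h -> isteps n h u = h u.
Proof.
move=> hh; elim: n u => // n IHn u; rewrite istepsS (eq_step (fun v _ => IHn v)).
exact/esym/hh.
Qed.

(** The end points of paths of [n] steps from [rho] form a finite set, and by connectedness these
    sets cover [V]. The enumeration may repeat vertices. *)
Lemma vertices_enumerable (rho : V) : exists vs : nat -> V, forall v, exists n, vs n = v.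
Proof.
pose ball n := iter n (fun B => \bigcup_(u in B) nb u) [set rho].
have fball n : finite_set (ball n).
  elim: n => [|n IHn]; first exact: finite_set1.
  by apply: bigcup_finite => // u _; exact: finite_nbrs.
have cover : countable [set: V].
  apply: sub_countable (bigcup_countable (countableP [set: nat])
    (fun n _ => finite_set_countable (fball n))).
  apply: subset_card_le => v _.
  have [_ _ /(_ rho v)[n [x [x0 <- xS]]]] := net.
  exists n => //.
  suff : forall k, (k <= n)%N -> ball k (x k) by apply.
  elim=> [|k IHk] kn; first by rewrite x0.
  by exists (x k); [exact/IHk/ltnW|exact: xS].
have /countable_injP[f finj] := cover.
pose vs n : V := if pselect (exists v, f v = n) is left e then projT1 (cid e) else rho.
exists vs => v; exists (f v); rewrite /vs; case: pselect => [e|]; last by case; exists v.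
by case: cid => w /= fwv; apply: finj fwv; exact: mem_set.
Qed.

End Network.
Arguments eq_step {R V E src tgt c g1 g2 u} _.

(** * Path space and martingale convergence *)

(** [v0] only makes the type pointed, as measurable types have to be. *)
Definition path_space (V : choiceType) (v0 : V) : Type := nat -> V.

Section PathSpace.
Variables (V : choiceType) (v0 : V).

Definition cylinder (n : nat) (x : nat -> V) : set (nat -> V) :=
  [set z | forall i, (i <= n)%N -> z i = x i].

(** With [set0] added the cylinders are closed under intersection, as Dynkin induction requires. *)
Definition cylinders : set (set (nat -> V)) :=
  [set A | A = set0 \/ exists n x, A = cylinder n x].

HB.instance Definition _ := gen_eqMixin (path_space v0).
HB.instance Definition _ := gen_choiceMixin (path_space v0).
HB.instance Definition _ := isPointed.Build (path_space v0) (fun=> v0).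
HB.instance Definition _ := @isMeasurable.Build (sigma_display cylinders)
  (path_space v0) <<s cylinders >> (@sigma_algebra0 _ setT cylinders)
  (fun A => @sigma_algebraC (path_space v0) cylinders A)
  (@sigma_algebra_bigcup _ setT cylinders).

Local Notation path_space := (path_space v0).

Definition pshift (n : nat) (z : nat -> V) : nat -> V := fun k => z (n + k)%N.

Lemma setI_closed_cylinders : setI_closed cylinders.
Proof.
have incl n m x y : (n <= m)%N ->
    cylinders (cylinder n x `&` cylinder m y).
  move=> nm; have [xy|] := pselect (forall i, (i <= n)%N -> y i = x i).
    right; exists m, y; apply/seteqP; split => z /=; first by case.
    by move=> zy; split => // i ni; rewrite zy ?xy// (leq_trans ni).
  move=> nxy; left; rewrite -subset0 => z [/= zx zy].
  by apply: nxy => i ni; rewrite -zx// zy// (leq_trans ni).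
move=> A B [->|[n [x ->]]]; first by left; rewrite set0I.
move=> [->|[m [y ->]]]; first by left; rewrite setI0.
have [nm|/ltnW mn] := leqP n m; first exact: incl.
by rewrite setIC; exact: incl.
Qed.

Variable vs : nat -> V.
Hypothesis vs_surj : forall v, exists n, vs n = v.

(** The event is a union of cylinders, countable because their prefixes are coded by finite
    sequences of indices into [vs]. *)
Lemma measurable_depends (n : nat) (A : set (nat -> V)) :
  (forall z z', (forall i, (i <= n)%N -> z i = z' i) -> A z -> A z') ->
  measurable (A : set path_space).
Proof.
move=> Adep.
pose x (s : seq nat) (i : nat) := vs (nth 0%N s i).
rewrite (_ : A = \bigcup_s (if `[< A (x s) >] then cylinder n (x s) else set0)).
  apply: countable_bigcupT_measurable; first exact: countableP.
  move=> s;  case: ifP => _; last exact: measurable0.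
  by apply: sub_sigma_algebra; right; exists n, (x s).
apply/seteqP; split=> [z Az|z [s _]].
  pose k i := projT1 (cid (vs_surj (z i))).
  exists (mkseq k n.+1) => //.
  have xz i : (i <= n)%N -> x (mkseq k n.+1) i = z i.
    by move=> ni; rewrite /x nth_mkseq// /k; case: cid.
  case: ifPn => [_ i ni|/asboolPn nAx]; first by rewrite xz.
  by case: nAx; apply: Adep Az => i ni; rewrite xz.
by case: ifPn => //= /asboolP Ax zx; apply: Adep Ax => i ni; rewrite zx.
Qed.

Lemma measurable_coord (n : nat) (B : set V) :
  measurable ([set z | B (z n)] : set path_space).
Proof. by apply: (@measurable_depends n) => z z' /(_ _ (leqnn n)) /= ->. Qed.

Lemma measurable_pshift (n : nat) (B : set path_space) :
  measurable B -> measurable (pshift n @^-1` B : set path_space).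
Proof.
move=> mB; rewrite -[X in measurable X]setTI; move: B mB.
suff mf : measurable_fun setT (pshift n : path_space -> path_space) by apply: mf.
apply: (@measurability _ _ path_space path_space setT (pshift n) cylinders) => //.
move=> _ [_ [->|[m [x ->]]] <-]; first by rewrite preimage_set0 setI0; exact: measurable0.
rewrite setTI; apply: (@measurable_depends (n + m)) => z z' zz' zx i im.
by rewrite -zx// /pshift zz'// leq_add2l.
Qed.

End PathSpace.

(** * The Markov property, maximal inequalities and convergence of bounded harmonic functions along
    the walk *)

Section Walk.
Variables (R : realType) (V E : choiceType) (src tgt : E -> V) (c : E -> R).
Hypothesis net : is_network src tgt c.
Hypothesis inc_n0 : forall u, incident src tgt u !=set0.
Variables (d : measure_display) (Om : measurableType d)
  (P : V -> probability Om R) (X : nat -> Om -> V).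
Hypothesis rw : is_random_walk src tgt c P X.
Variable vs : nat -> V.
Hypothesis vs_surj : forall v, exists n, vs n = v.

Local Notation p := (trans_prob src tgt c).
Local Notation nb := (nbrs src tgt).
Local Notation step := (walk_step src tgt c).
Local Notation isteps := (walk_steps src tgt c).
Variable v0 : V.
Local Notation T := (path_space v0).

Definition trajectory (w : Om) : T := fun n => X n w.

Lemma measurable_trajectory : measurable_fun setT trajectory.
Proof.
apply: (@measurability _ _ Om T setT trajectory (@cylinders V)) => //.
move=> _ [_ [->|[m [x ->]]] <-]; first by rewrite preimage_set0 setI0; exact: measurable0.
rewrite setTI (_ : _ @^-1` _ = \bigcap_(i in [set i | (i <= m)%N]) (X i @^-1` [set x i])).
  apply: bigcap_measurable; first by exists 0%N.
  by move=> i _; case: rw => + _; apply.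
by apply/seteqP; split.
Qed.

(** The law of the trajectory, on path space because [Om] carries no shift, and real-valued so that
    [walk_step] can act on it as a function of the start. *)
Definition path_prob (v : V) (A : set T) : R := fine (P v (trajectory @^-1` A)).

Local Notation pr := path_prob.

Lemma measurable_pr (A : set T) : measurable A -> measurable (trajectory @^-1` A).
Proof. by move=> mA; rewrite -[X in measurable X]setTI; exact: measurable_trajectory. Qed.

Lemma prE v (A : set T) : measurable A -> P v (trajectory @^-1` A) = (pr v A)%:E.
Proof. by move=> mA; rewrite fineK// fin_num_measure//; exact: measurable_pr. Qed.

Lemma pr_ge0 v A : 0 <= pr v A.
Proof. by rewrite fine_ge0. Qed.

Lemma prT v : pr v setT = 1.
Proof. by rewrite /path_prob preimage_setT probability_setT. Qed.

Lemma pr0 v : pr v set0 = 0.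
Proof. by rewrite /path_prob preimage_set0 measure0. Qed.

Lemma le_pr v (A B : set T) : measurable A -> measurable B -> A `<=` B -> pr v A <= pr v B.
Proof.
move=> mA mB AB; rewrite -lee_fin -!prE//.
by apply: le_measure; rewrite ?inE; [exact: measurable_pr|exact: measurable_pr|move=> w /AB].
Qed.

Lemma pr_le1 v (A : set T) : measurable A -> pr v A <= 1.
Proof. by move=> mA; rewrite -(prT v); apply: le_pr. Qed.

Lemma prDU v (A B : set T) : measurable A -> measurable B -> A `&` B = set0 ->
  pr v (A `|` B) = pr v A + pr v B.
Proof.
move=> mA mB AB; apply: EFin_inj; rewrite EFinD -!prE//; last exact: measurableU.
rewrite preimage_setU measureU//; [exact: measurable_pr|exact: measurable_pr|].
by rewrite -preimage_setI AB preimage_set0.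
Qed.

Lemma prC v (A : set T) : measurable A -> pr v (~` A) = 1 - pr v A.
Proof.
move=> mA; apply/eqP; rewrite eq_sym subr_eq addrC -prDU ?setUv ?prT ?setICr//.
exact: measurableC.
Qed.

Lemma pr_bigcup v (F : (set T)^nat) : (forall n, measurable (F n)) -> trivIset setT F ->
  (fun n => \sum_(0 <= i < n) pr v (F i)) @ \oo --> pr v (\bigcup_n F n).
Proof.
move=> mF tF; have mU := bigcupT_measurable _ mF.
have : (fun n => (\sum_(0 <= i < n) P v (trajectory @^-1` F i))%E) @ \oo -->
    P v (trajectory @^-1` (\bigcup_n F n)).
  rewrite preimage_bigcup; apply: measure_sigma_additive => [n|]; first exact: measurable_pr.
  by move=> i j _ _ [w [Fi Fj]]; apply: (tF i j) => //; exists (trajectory w).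
rewrite prE// (_ : (fun n => _) = EFin \o (fun n => \sum_(0 <= i < n) pr v (F i))).
  by move=> /fine_cvgP[].
by apply/funext => n /=; rewrite -sumEFin; apply: eq_bigr => i _; rewrite prE.
Qed.

Lemma nondecreasing_cvg_pr v (F : (set T)^nat) : (forall n, measurable (F n)) ->
  nondecreasing_seq F -> pr v \o F @ \oo --> pr v (\bigcup_n F n).
Proof.
move=> mF ndF; have mU := bigcupT_measurable _ mF.
have : (P v \o (fun n => trajectory @^-1` F n)) @ \oo --> P v (trajectory @^-1` (\bigcup_n F n)).
  rewrite preimage_bigcup; apply: nondecreasing_cvg_mu.
  - by move=> n; exact: measurable_pr.
  - by rewrite -preimage_bigcup; exact: measurable_pr.
  - by move=> m n mn; apply/subsetPset => w; move/ndF: mn => /subsetPset; apply.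
by rewrite prE// => /fine_cvgP[].
Qed.

Lemma pr_ae v (A : set T) : measurable A ->
  pr v (~` A) = 0 <-> {ae P v, forall w, A (trajectory w)}.
Proof.
move=> mA; have mCA := measurableC mA.
have mC := measurable_pr mCA.
change (pr v (~` A) = 0 <-> (P v).-negligible (trajectory @^-1` (~` A))).
split => [A0|/(measure_negligible mC) A0]; first by apply/(negligibleP _ mC); rewrite /= prE// A0.
by apply: EFin_inj; rewrite -prE.
Qed.

Lemma eq_pr v (A B : set T) : measurable A -> measurable B ->
  {ae P v, forall w, A (trajectory w) <-> B (trajectory w)} -> pr v A = pr v B.
Proof.
move=> mA mB AB; rewrite /path_prob; congr fine.
suff sub (C D : set T) : measurable C -> measurable D ->
    {ae P v, forall w, C (trajectory w) -> D (trajectory w)} ->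
    (P v (trajectory @^-1` C) <= P v (trajectory @^-1` D))%E.
  by apply/eqP; rewrite eq_le !sub//; apply: filterS AB => w [].
move=> mC mD [N [mN N0 CD]].
have : (P v (trajectory @^-1` D `|` N) <= P v (trajectory @^-1` D) + P v N)%E.
  by apply: measureU2 => //; exact: measurable_pr.
rewrite [X in (_ + X)%E]N0 adde0; apply: le_trans; apply: le_measure; rewrite ?inE.
- exact: measurable_pr.
- by apply: measurableU => //; exact: measurable_pr.
- move=> w Cw; have [Nw|nNw] := pselect (N w); [by right|left].
  by apply: contrapT => nD; apply: nNw; apply: CD => /(_ Cw).
Qed.

Lemma pr_cylinder v n x : pr v (cylinder n x) =
  (x 0%N == v)%:R * \prod_(i < n) p (x i) (x i.+1).
Proof. by rewrite /path_prob (_ : trajectory @^-1` _ = [set w | forall i, (i <= n)%N -> X i w = x i])// (proj2 rw). Qed.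

Lemma ae_start v : {ae P v, forall w, X 0 w = v}.
Proof.
apply/(@pr_ae v [set z | z 0%N = v]); first exact: (measurable_coord v0 vs_surj 0%N [set v]).
rewrite prC; last exact: (measurable_coord v0 vs_surj 0%N [set v]).
rewrite (_ : [set z | _] = cylinder 0 (fun=> v)); first by rewrite pr_cylinder eqxx big_ord0 mulr1 subrr.
apply/seteqP; split => z; last by apply.
by move=> /= z0 [].
Qed.

(** Dynkin induction: on cylinders this is the product formula, and the finite sum [walk_step] is
    compatible with complements and with countable disjoint unions. *)
Lemma markov1 v (A : set T) : measurable A ->
  pr v (pshift 1 @^-1` A) = step (pr^~ A) v.
Proof.
have fn := finite_nbrs net v.
have mshift := @measurable_pshift _ v0 _ vs_surj 1.
move=> mA; apply: (@dynkin_induction _ T (@cylinders V)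
  (fun A => pr v (pshift 1 @^-1` A) = step (pr^~ A) v) _ _ _ _ _ _ A mA) => //.
- exact: setI_closed_cylinders.
- by rewrite preimage_setT prT (eq_step (g2 := fun=> 1)) ?step_cst// => u _; rewrite prT.
- move=> _ [->|[n [x ->]]].
    by rewrite preimage_set0 pr0 (eq_step (g2 := fun=> 0)) ?step_cst// => u _; rewrite pr0.
  (* [x'] puts the start in front of [x]; for the walk from [v] the shifted cylinder and the
     cylinder of [x'] agree almost surely. *)
  pose x' k := if k is k'.+1 then x k' else v.
  rewrite (@eq_pr _ _ (cylinder n.+1 x')).
  + rewrite pr_cylinder eqxx mul1r big_ord_recl /=.
    rewrite /Defs.nbrs /walk_step.
    have [vx|vx] := pselect (nb v (x 0%N)).
      rewrite (fsbigD1 (x 0%N))//= fsbig1 ?addr0 ?pr_cylinder ?eqxx ?mul1r//.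
      by move=> u [_ /eqP ux]; rewrite pr_cylinder eq_sym (negbTE ux) mul0r mulr0.
    rewrite /trans_prob (cond_pair_eq0 _ vx) !mul0r fsbig1// => u vu.
    rewrite pr_cylinder; case: eqP => [xu|]; last by rewrite mul0r mulr0.
    by case: vx; rewrite xu.
  + by apply: mshift; apply: sub_sigma_algebra; right; exists n, x.
  + by apply: sub_sigma_algebra; right; exists n.+1, x'.
  + apply: filterS (ae_start v) => w X0; split => Aw.
      by move=> [_|i ni]; [exact: X0|exact: (Aw i)].
    by move=> i ni; exact: (Aw i.+1).
- move=> B mB IH; rewrite -preimage_setC prC ?IH//; last exact: mshift.
  rewrite -[in LHS](step_cst net inc_n0 1 v) -stepB//.
  by apply: eq_step => u _; rewrite prC.
- move=> F mF tF IH; rewrite preimage_bigcup.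
  have tF' : trivIset setT (fun n => pshift 1 @^-1` F n : set T).
    by move=> i j _ _ [w [Fi Fj]]; apply: (tF i j) => //; exists (pshift 1 w).
  have h1 := @pr_bigcup v _ (fun n => mshift _ (mF n)) tF'.
  have h2 : (fun n => step (fun u => \sum_(0 <= i < n) pr u (F i)) v) @ \oo -->
      step (pr^~ (\bigcup_k F k)) v.
    by apply: (step_cvg net) => u; exact: pr_bigcup.
  rewrite -(cvg_lim _ h1)// -(cvg_lim _ h2)//; congr (limn _); apply/funext => n.
  elim: n => [|n IHn]; first by rewrite big_geq// (eq_step (g2 := fun=> 0)) ?step_cst// => u _; rewrite big_geq.
  rewrite big_nat_recr//= IHn IH// -stepD//.
  by apply: eq_step => u _; rewrite big_nat_recr.
Qed.

Lemma markov_pshift n v (A : set T) : measurable A ->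
  pr v (pshift n @^-1` A) = isteps n (pr^~ A) v.
Proof.
move=> mA; elim: n v => [v|n IHn v]; first by rewrite (_ : pshift 0 @^-1` A = A).
rewrite (_ : pshift n.+1 @^-1` A = pshift 1 @^-1` (pshift n @^-1` A)).
  rewrite markov1; first by rewrite istepsS; apply: eq_step => u _; exact: IHn.
  exact: (measurable_pshift vs_surj).
apply/seteqP; split => z; rewrite /preimage /pshift /=;
  by rewrite (_ : (fun k => z (n.+1 + k)%N) = (fun k => z (1 + (n + k))%N)).
Qed.

Lemma ae_nbrs v : {ae P v, forall w n, nb (X n w) (X n.+1 w)}.
Proof.
apply: ae_foralln => n.
pose A := [set z : T | nb (z 0%N) (z 1%N)].
have mA : measurable A.
  by apply: (@measurable_depends _ v0 _ vs_surj 1) => z z' zz'; rewrite /A /= !zz'.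
have mS := @measurable_pshift _ v0 _ vs_surj.
suff /pr_ae : pr v (~` (pshift n @^-1` A)) = 0.
  move=> /(_ (mS _ _ mA)); apply: filterS => w.
  by rewrite /A /preimage /= /pshift addn0 addn1.
rewrite preimage_setC markov_pshift; last exact: measurableC.
rewrite -[RHS](isteps_cst net inc_n0 n 0 v).
have A0 u : pr u (~` A) = 0.
  rewrite (@eq_pr _ _ (pshift 1 @^-1` [set z | ~ nb u (z 0%N)])).
  - rewrite markov1; last exact: (measurable_coord v0 vs_surj 0%N (~` nb u)).
    rewrite -[RHS](step_cst net inc_n0 0 u); apply: eq_step => w uw.
    rewrite (@eq_pr _ _ set0) ?pr0//; first exact: (measurable_coord v0 vs_surj 0%N (~` nb u)).
    by apply: filterS (ae_start w) => o X0; split => //=; rewrite /trajectory X0.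
  - exact: measurableC.
  - by apply: (mS 1%N [set z | ~ nb u (z 0%N)]); exact: (measurable_coord v0 vs_surj 0%N (~` nb u)).
  - by apply: filterS (ae_start u) => o X0; rewrite /A /preimage /= /pshift /trajectory X0.
by congr (isteps n _ _); apply/funext.
Qed.

Lemma ae_transfer u (A : set T) : measurable A -> (forall z, A z -> A (pshift 1 z)) ->
  {ae P u, forall w, A (trajectory w)} -> forall v, {ae P v, forall w, A (trajectory w)}.
Proof.
move=> mA shA /(pr_ae _ mA) uA v; apply/(pr_ae _ mA).
have mCA := measurableC mA.
have [_ _ /(_ u v)[n [x [x0 <- xS]]]] := net.
suff : forall k, (k <= n)%N -> pr (x k) (~` A) = 0 by apply.
elim=> [_|k IHk kn]; first by rewrite x0.
have : step (pr^~ (~` A)) (x k) = 0.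
  apply/eqP; rewrite eq_le (step_ge0 net inc_n0) ?andbT; last by move=> ?; exact: pr_ge0.
  rewrite -markov1// -(IHk (ltnW kn)); apply: le_pr => //.
    exact: (measurable_pshift vs_surj).
  by move=> z /=; apply: contra_not; exact: shA.
have := pr_ge0 (x k.+1) (~` A); rewrite le_eqVlt => /predU1P[//|xA].
move/eqP; rewrite gt_eqF//; apply: (step_gt0 net inc_n0 _ (xS _ kn)) => // w.
exact: pr_ge0.
Qed.

Lemma ae_exists_not v (B : (set T)^nat) (r : nat -> R) :
  (forall n, measurable (B n)) -> (forall n, pr v (B n) <= r n) -> r @ \oo --> 0 ->
  {ae P v, forall w, exists n, ~ B n (trajectory w)}.
Proof.
move=> mB Br r0.
have mA : measurable (\bigcup_n (~` B n)).
  by apply: bigcupT_measurable => n; exact: measurableC.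
suff /(pr_ae _ mA) : pr v (~` \bigcup_n (~` B n)) = 0 by apply: filterS => w [n _ ?]; exists n.
apply/eqP; rewrite eq_le pr_ge0 andbT; apply/ler_addgt0Pr => e e0; rewrite add0r.
have /cvgr_lt/(_ _ e0)[n _ /(_ _ (leqnn n)) /= rn] := r0.
apply: le_trans (ltW rn); apply: le_trans (Br n); apply: le_pr => //.
  exact: measurableC.
by move=> z /= nBz; apply: contrapT => nBn; apply: nBz; exists n.
Qed.

Definition hits (N : nat) (B : set V) : set T := [set z | exists2 k, (k <= N)%N & B (z k)].

Lemma measurable_hits N B : measurable (hits N B).
Proof.
apply: (@measurable_depends _ v0 _ vs_surj N) => z z' zz' [k kN Bz].
by exists k => //; rewrite -zz'.
Qed.

Lemma pr_hits_out N (B : set V) v : ~ B v -> pr v (hits N.+1 B) = step (pr^~ (hits N B)) v.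
Proof.
move=> nBv; rewrite -markov1; last exact: measurable_hits.
apply: eq_pr; [exact: measurable_hits|exact: (measurable_pshift vs_surj _ (measurable_hits _ _))|].
apply: filterS (ae_start v) => w X0; split => [[[|k] kN Bk]|[k kN Bk]].
- by case: nBv; rewrite -X0.
- by exists k.
- by exists k.+1.
Qed.

Lemma pr_hits0_out (B : set V) v : ~ B v -> pr v (hits 0 B) = 0.
Proof.
move=> nBv; rewrite -(pr0 v); apply: eq_pr => //; first exact: measurable_hits.
apply: filterS (ae_start v) => w X0; split => // -[k].
by rewrite leqn0 => /eqP -> /=; rewrite /trajectory X0.
Qed.

Section MaximalInequalities.
Variables (g : V -> R) (e : R).
Hypotheses (g_ge0 : forall u, 0 <= g u) (e_gt0 : 0 < e).

(** Ville's inequality by induction on the horizon: where [e <= g v] the bound is at least 1,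
    elsewhere the first step is averaged and [g] does not grow in mean. *)
Lemma supermartingale_maximal N v : (forall u, step g u <= g u) ->
  pr v (hits N [set u | e <= g u]) <= g v / e.
Proof.
move=> gsup; elim: N v => [v|N IHN v].
  have [ev|ev] := leP e (g v).
    by apply: le_trans (pr_le1 _ (measurable_hits _ _)) _; rewrite ler_pdivlMr// mul1r.
  rewrite pr_hits0_out; first by rewrite divr_ge0// ltW.
  by apply/negP; rewrite -ltNge.
have [ev|ev] := leP e (g v).
  by apply: le_trans (pr_le1 _ (measurable_hits _ _)) _; rewrite ler_pdivlMr// mul1r.
rewrite pr_hits_out; last by apply/negP; rewrite -ltNge.
apply: (@le_trans _ _ (step (fun u => e^-1 * g u) v)).
  by apply: (ler_step net inc_n0) => u _; rewrite mulrC.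
by rewrite stepZ// mulrC ler_wpM2r// invr_ge0 ltW.
Qed.

Lemma isteps_subharmonic N v : (forall u, g u <= step g u) -> g v <= isteps N g v.
Proof.
move=> gsub; elim: N v => // N IHN v; apply: le_trans (gsub v) _.
by rewrite istepsS; apply: (ler_step net inc_n0).
Qed.

(** Doob's inequality by the same induction; the mean is taken at the horizon, where it is
    largest. *)
Lemma submartingale_maximal N v : (forall u, g u <= step g u) ->
  pr v (hits N [set u | e <= g u]) <= isteps N g v / e.
Proof.
move=> gsub; elim: N v => [v|N IHN v].
  have [ev|ev] := leP e (g v).
    by apply: le_trans (pr_le1 _ (measurable_hits _ _)) _; rewrite ler_pdivlMr// mul1r.
  rewrite pr_hits0_out; first by rewrite divr_ge0// ltW.
  by apply/negP; rewrite -ltNge.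
have [ev|ev] := leP e (g v).
  apply: le_trans (pr_le1 _ (measurable_hits _ _)) _; rewrite ler_pdivlMr// mul1r.
  by apply: le_trans ev _; exact: isteps_subharmonic.
rewrite pr_hits_out; last by apply/negP; rewrite -ltNge.
rewrite istepsS; apply: (@le_trans _ _ (step (fun u => e^-1 * isteps N g u) v)).
  by apply: (ler_step net inc_n0) => u _; rewrite mulrC.
by rewrite stepZ// mulrC.
Qed.

End MaximalInequalities.

(** The maximal inequality restarted at time [n] bounds the chance of reaching level [e] after time
    [n] by [isteps n g v / e], which tends to 0. *)
Lemma supermartingale_cvg0 (g : V -> R) v : (forall u, 0 <= g u) -> (forall u, step g u <= g u) ->
  (isteps n g v @[n --> \oo] --> 0) -> {ae P v, forall w, g (X n w) @[n --> \oo] --> 0}.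
Proof.
move=> g0 gsup gcvg.
have h (j : nat) : {ae P v, forall w, exists n, forall k, g (X (n + k) w) < j.+1%:R^-1}.
  set e : R := j.+1%:R^-1; have e0 : 0 < e by rewrite invr_gt0.
  pose B n : set T := pshift n @^-1` (\bigcup_N hits N [set u | e <= g u]).
  have mU : measurable (\bigcup_N hits N [set u | e <= g u]).
    by apply: bigcupT_measurable => N; exact: measurable_hits.
  have : {ae P v, forall w, exists n, ~ B n (trajectory w)}.
    apply: (@ae_exists_not _ _ (fun n => e^-1 * isteps n g v)).
    - by move=> n; exact: (measurable_pshift vs_surj).
    - move=> n; rewrite /B markov_pshift// -istepsZ//; apply: (ler_isteps net inc_n0) => u.
      have ndh : nondecreasing_seq (fun N => hits N [set u | e <= g u]).
        by move=> a b ab; apply/subsetPset => z [k ka ?]; exists k => //; exact: leq_trans ab.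
      have hc := nondecreasing_cvg_pr (v := u) (fun N => measurable_hits N _) ndh.
      rewrite -(cvg_lim _ hc)//; apply: limr_le; first by apply/cvg_ex; eexists; exact: hc.
      by near=> N; rewrite /= mulrC; exact: supermartingale_maximal.
    - by rewrite -[X in _ --> X](mulr0 e^-1); apply: cvgM => //; exact: cvg_cst.
  apply: filterS => w [n nB]; exists n => k; rewrite ltNge; apply/negP => ek.
  by apply: nB; exists k => //; exists k.
apply: filterS (ae_foralln h) => w hw.
apply/cvgrPdist_lt => e e0.
have [j je] : exists j, j.+1%:R^-1 < e.
  have [j] := near_infty_natSinv_lt (PosNum e0).
  by move=> _ /(_ j (leqnn j)) /= ?; exists j.
have [n nk] := hw j; exists n => // m /= nm.
rewrite sub0r normrN ger0_norm//; apply: lt_trans je.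
by rewrite -(subnKC nm).
Unshelve. all: by end_near. Qed.

(** Kolmogorov's inequality: the square of [h - h u] is a submartingale, and since [h] keeps its
    mean [h u], the mean of that square is the growth of the mean of the square of [h]. *)
Lemma harmonic_maximal h N e u : is_harmonic src tgt c h -> 0 < e ->
  pr u [set z | exists2 k, (k <= N)%N & e <= `|h (z k) - h (z 0%N)|] <=
  (isteps N (fun x => h x ^+ 2) u - h u ^+ 2) / e ^+ 2.
Proof.
move=> hh e0; pose g x := (h x - h u) ^+ 2.
have gE n : isteps n g u = isteps n (fun x => h x ^+ 2) u - h u ^+ 2.
  transitivity (isteps n (fun x => h x ^+ 2 + (- (2 * h u) * h x + h u ^+ 2)) u).
    by congr (isteps n _ _); apply/funext => x; rewrite /g; ring.
  by rewrite istepsD// istepsD// istepsZ// isteps_cst// (isteps_harmonic _ _ hh); ring.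
have gsub x : g x <= step g x.
  apply: le_trans (step_sqr_ge net inc_n0 _ _).
  by rewrite stepB// step_cst// (esym (hh x) : step h x = h x).
rewrite (@eq_pr _ _ (hits N [set x | e ^+ 2 <= g x])).
- rewrite -gE; apply: submartingale_maximal => [x||x].
  + exact: sqr_ge0.
  + by rewrite exprn_gt0.
  + exact: gsub.
- apply: (@measurable_depends _ v0 _ vs_surj N) => z z' zz' [k kN Bz].
  by exists k => //; rewrite -!zz'.
- exact: measurable_hits.
apply: filterS (ae_start u) => w X0.
have eq k : (e <= `|h (X k w) - h u|) = (e ^+ 2 <= g (X k w)).
  by rewrite /g -[in RHS](real_normK (num_real (h (X k w) - h u))) ler_sqr// ?nnegrE// ltW.
by split => -[k kN]; rewrite /trajectory ?X0 /= => ek; exists k => //; rewrite /= ?X0; move: ek; rewrite eq.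
Qed.

(** The mean of the square of [h] increases to a finite limit, so by Kolmogorov's inequality
    oscillations of size [e] after a late time are improbable; almost every path is Cauchy. *)
Lemma harmonic_cvg h M v : is_harmonic src tgt c h -> (forall u, `|h u| <= M) ->
  {ae P v, forall w, cvgn (fun n => h (X n w))}.
Proof.
move=> hh hM; pose sq u := h u ^+ 2; pose a n := isteps n sq v.
have sqsub u : sq u <= step sq u.
  by rewrite {1}/sq (hh u : h u = step h u); exact: (step_sqr_ge net inc_n0).
have nda : nondecreasing_seq a.
  apply/nondecreasing_seqP => n; rewrite /a -[n.+1]addn1 isteps_add.
  exact: (ler_isteps net inc_n0).
have aM n : a n <= M ^+ 2.
  rewrite -(isteps_cst net inc_n0 n (M ^+ 2) v); apply: (ler_isteps net inc_n0) => u.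
  have M0 : 0 <= M := le_trans (normr_ge0 _) (hM u).
  by rewrite /sq -real_normK ?num_real// ler_sqr ?nnegrE.
have acvg : cvgn a.
  by apply: nondecreasing_is_cvgn => //; exists (M ^+ 2) => _ [n _ <-].
have h1 (j : nat) : {ae P v, forall w, exists n, forall k,
    `|h (X (n + k) w) - h (X n w)| < j.+1%:R^-1}.
  set e : R := j.+1%:R^-1; have e0 : 0 < e by rewrite invr_gt0.
  pose D N : set T := [set z | exists2 k, (k <= N)%N & e <= `|h (z k) - h (z 0%N)|].
  have mD N : measurable (D N).
    apply: (@measurable_depends _ v0 _ vs_surj N) => z z' zz' [k kN Bz].
    by exists k => //; rewrite -!zz'.
  pose B n : set T := \bigcup_N (pshift n @^-1` (D N)).
  have mB n N : measurable (pshift n @^-1` (D N) : set T) by exact: (measurable_pshift vs_surj).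
  have : {ae P v, forall w, exists n, ~ B n (trajectory w)}.
    apply: (@ae_exists_not _ _ (fun n => (limn a - a n) / e ^+ 2)).
    - by move=> n; apply: bigcupT_measurable => N; exact: mB.
    - move=> n.
      have ndh : nondecreasing_seq (fun N => pshift n @^-1` (D N) : set T).
        by move=> k l kl; apply/subsetPset => z [i ik ?]; exists i => //; exact: leq_trans kl.
      have hc := nondecreasing_cvg_pr (v := v) (mB n) ndh.
      rewrite -(cvg_lim _ hc)//; apply: limr_le; first by apply/cvg_ex; eexists; exact: hc.
      near=> N; rewrite /= markov_pshift//.
      apply: (@le_trans _ _ (isteps n (fun u => (e ^+ 2)^-1 * (isteps N sq u + - 1 * sq u)) v)).
        apply: (ler_isteps net inc_n0) => u; rewrite mulrC mulN1r.
        exact: harmonic_maximal.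
      rewrite istepsZ// istepsD// istepsZ// -isteps_add mulrC mulN1r ler_wpM2r//.
        by rewrite invr_ge0 exprn_ge0// ltW.
      by rewrite lerB//; exact: nondecreasing_cvgn_le.
    - rewrite -[X in _ --> X](mul0r (e ^+ 2)^-1) -(subrr (limn a)).
      by apply: cvgM; [apply: cvgB => //; exact: cvg_cst|exact: cvg_cst].
  apply: filterS => w [n nB]; exists n => k; rewrite ltNge; apply/negP => ek.
  by apply: nB; exists k => //; exists k => //; rewrite /pshift addn0.
apply: filterS (ae_foralln h1) => w hw.
apply: cauchy_cvg; apply/cauchy_ballP => e e0.
have [j je] : exists j, j.+1%:R^-1 < e / 2.
  have [j] := near_infty_natSinv_lt (PosNum (divr_gt0 e0 (ltr0Sn R 1))).
  by move=> _ /(_ j (leqnn j)) /= ?; exists j.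
have [n nk] := hw j.
exists ([set x | `|x - h (X n w)| < e / 2], [set x | `|x - h (X n w)| < e / 2]).
  by split; exists n => // m /= nm; apply: lt_trans je; rewrite -(subnKC nm).
move=> [x x'] /= [xn x'n]; rewrite -ball_normE /= (splitr e).
rewrite (_ : x - x' = (x - h (X n w)) - (x' - h (X n w))); last by ring.
by rewrite (le_lt_trans (ler_normB _ _))// ltrD.
Unshelve. all: by end_near. Qed.

End Walk.

(** * Planarity of the tiling *)

Section Tiling.
Variables (R : realType) (V E : choiceType) (src tgt : E -> V) (c : E -> R).
Variables (d : measure_display) (Om : measurableType d)
  (P : V -> probability Om R) (X : nat -> Om -> V) (rho : V) (a : E -> R).

Local Notation joins := (joins src tgt).
Local Notation inc := (incident src tgt).
Local Notation y := (yv P X rho).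
Local Notation eta := (eta_cyl src tgt c P X rho).
Local Notation ylo := (ylo src tgt P X rho).
Local Notation yhi := (yhi src tgt P X rho).
Local Notation len := (len src tgt c P X rho).
Local Notation carc := (Defs.arc src tgt c P X rho).
Local Notation Iedge := (Iedge src tgt c P X rho a).
Local Notation rect := (rect src tgt c P X rho a).
Local Notation out_edges := (out_edges src tgt P X rho).
Local Notation in_edges := (in_edges src tgt P X rho).
Local Notation Ivert := (Ivert src tgt c P X rho a).

Hypothesis c_gt0 : forall e, 0 < c e.
Hypothesis rect_disj : forall e1 e2, e1 <> e2 ->
  interior (rect e1) `&` interior (rect e2) = set0.
Hypothesis rect_cover : \bigcup_(e in [set: E]) rect e = [set p | 0 <= p.2 < 1].
Hypothesis Ivert_arc : forall v, is_arc src tgt c P X rho (Ivert v).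
Hypothesis Ivert_in : forall v, v <> rho -> Ivert v = \bigcup_(e in in_edges v) Iedge e.
Hypothesis eta_gt0 : 0 < eta.
Hypothesis y_ge0 : forall v, 0 <= y v.
Hypothesis y_rho : y rho = 0.
Hypothesis countable_edges : countable [set: E].

Definition open_arc (e : E) : set R :=
  [set x | exists k : int, a e < x + k%:~R * eta < a e + len e].

(** The lifted angles of all vertical sides. Off this countable set an angle of an edge is interior
    to it, so the disjointness of interiors can be used to identify edges. *)
Definition side_angles : set R :=
  [set x | exists e (k : int), x + k%:~R * eta = a e \/ x + k%:~R * eta = a e + len e].

Lemma ylo_le_yhi e : ylo e <= yhi e.
Proof. by rewrite /Defs.ylo /Defs.yhi ge_min le_max lexx. Qed.

Lemma len_gt0 e : (0 < len e) = (ylo e < yhi e).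
Proof. by rewrite /Defs.len pmulr_rgt0// subr_gt0. Qed.

Lemma joins_heights e u v : joins e u v ->
  ylo e = Num.min (y u) (y v) /\ yhi e = Num.max (y u) (y v).
Proof.
by rewrite /Defs.ylo /Defs.yhi => -[[-> ->]|[-> ->]] //; rewrite minC maxC.
Qed.

Lemma out_edgesE e v : out_edges v e <-> inc v e /\ y v = ylo e.
Proof.
rewrite /out_edges /Defs.ylo /incident /=; split.
  by case=> -[<- yle]; split; [left|rewrite min_l|right|rewrite min_r].
by case=> -[<-|<-] /esym/eqP; rewrite (eq_minl, eq_minr) => ?; [left|right].
Qed.

Lemma in_edgesE e v : in_edges v e <-> inc v e /\ y v = yhi e.
Proof.
rewrite /in_edges /Defs.yhi /incident /=; split.
  by case=> -[<- yle]; split; [right|rewrite max_r|left|rewrite max_l].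
by case=> -[<-|<-] /esym/eqP; rewrite (eq_maxl, eq_maxr) => ?; [right|left].
Qed.

Lemma carc_shift b l x (k : int) : carc b l x -> carc b l (x + k%:~R * eta).
Proof.
move=> [j xj]; exists (j - k); rewrite intrB.
by rewrite (_ : x + _ + _ = x + j%:~R * eta)//; ring.
Qed.

Lemma Ivert_shift v x (k : int) : Ivert v x -> Ivert v (x + k%:~R * eta).
Proof. by move=> [e ve ex]; exists e => //; exact: carc_shift. Qed.

Lemma side_angles_shift x (k : int) : side_angles (x + k%:~R * eta) -> side_angles x.
Proof.
move=> [e [j xj]]; exists e, (j + k); rewrite intrD.
by rewrite (_ : x + _ = x + k%:~R * eta + j%:~R * eta)//; ring.
Qed.

Lemma countable_side_angles : countable side_angles.
Proof.
pose F (e : E) : set R := \bigcup_(k : int) [set a e - k%:~R * eta; a e + len e - k%:~R * eta].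
apply: (@sub_countable _ _ _ (\bigcup_(e in [set: E]) F e)); last first.
  apply: bigcup_countable => // e _; apply: bigcup_countable => // k _.
  exact/finite_set_countable/finite_set2.
apply: subset_card_le => x [e [k xk]]; exists e => //; exists k => //=.
by case: xk => <-; [left|right]; rewrite addrK.
Qed.

Lemma generic_angle u v : u < v -> exists2 x, u < x < v & ~ side_angles x.
Proof.
move=> uv; apply: contrapT => nx.
have /(countable_lebesgue_measure0 (R := R)) : countable `]u, v[%classic.
  apply: sub_countable countable_side_angles; apply: subset_card_le => x /=.
  by rewrite in_itv /= => xuv; apply: contrapT => nsx; apply: nx; exists x.
rewrite lebesgue_measure_itv /= lte_fin uv -EFinD => /eqP.
by rewrite eqe subr_eq0 gt_eqF.
Qed.

Lemma open_arc_generic e x : Iedge e x -> ~ side_angles x -> open_arc e x.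
Proof.
move=> [k /andP[ax xa]] nsx; exists k.
rewrite !lt_neqAle ax xa !andbT; apply/andP; split; apply/eqP => xe; apply: nsx.
  by exists e, k; left.
by exists e, k; right.
Qed.

Lemma open_arc_len e x : open_arc e x -> 0 < len e.
Proof. by move=> [k /andP[/lt_trans h /h]]; rewrite ltrDl. Qed.

Lemma rect_interior e x t : open_arc e x -> ylo e < t < yhi e -> interior (rect e) (x, t).
Proof.
move=> [k /andP[ax xa]] /andP[lt th].
exists (`]a e - k%:~R * eta, a e + len e - k%:~R * eta[%classic, `]ylo e, yhi e[%classic).
  split => /=; last by apply: near_in_itvoo; rewrite in_itv /= lt.
  by apply: near_in_itvoo; rewrite in_itv /= ltrBlDr ax ltrBrDr.
move=> [x' t'] /= [] /=; rewrite !in_itv /= => /andP[ax' xa'] /andP[lt' th'].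
split => /=; last by rewrite !ltW.
by exists k; move: ax' xa'; rewrite ltrBlDr ltrBrDr => /ltW -> /ltW ->.
Qed.

Lemma rect_overlap e1 e2 x t : open_arc e1 x -> open_arc e2 x ->
  ylo e1 < t < yhi e1 -> ylo e2 < t < yhi e2 -> e1 = e2.
Proof.
move=> x1 x2 t1 t2; apply: contrapT => /rect_disj; rewrite -subset0 => /(_ (x, t)); apply.
by split; exact: rect_interior.
Qed.

(** [Ivert] is built from outgoing edges; incoming ones are covered by property (3) of the tiling.
    An edge coming into [rho] has both heights 0, so it is outgoing as well. *)
Lemma Iedge_incident v e : inc v e -> Iedge e `<=` Ivert v.
Proof.
move=> ve x ex; have [ylohi|] := eqVneq (y v) (ylo e).
  by exists e => //; apply/out_edgesE.
move=> nlo; have vhi : y v = yhi e.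
  have : y v = ylo e \/ y v = yhi e.
    case: ve => <-; rewrite /Defs.ylo /Defs.yhi.
      by case: (leP (y (src e)) (y (tgt e))); [left|right].
    by case: (leP (y (src e)) (y (tgt e))); [right|left].
  by case=> // /eqP; rewrite (negbTE nlo).
rewrite Ivert_in; first by exists e => //; apply/in_edgesE.
move=> vr; move/eqP: nlo; apply; apply/eqP; rewrite eq_le vhi ylo_le_yhi andbT -vhi vr y_rho.
by rewrite /Defs.ylo le_min !y_ge0.
Qed.

Definition segment_in (S : set R) (u v : R) : Prop :=
  forall x, Num.min u v <= x <= Num.max u v -> S x.

Lemma segment_inC S u v : segment_in S u v -> segment_in S v u.
Proof. by rewrite /segment_in minC maxC. Qed.

Lemma Ivert_component v x x' : Ivert v x -> Ivert v x' ->
  exists k : int, segment_in (Ivert v) x (x' + k%:~R * eta).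
Proof.
have [b [l [_ ->]]] := Ivert_arc v => -[i xi] [j xj]; exists (j - i) => s ms; exists i.
have := xi; have := xj; have := ms; rewrite intrB ge_min le_max => /andP[/orP[] h1 /orP[] h2] h3 h4; lra.
Qed.

(** The inequality is not strict, to match arcs made of outgoing edges: an edge whose ends are
    separated at level [y u] reaches strictly above [y u], like the nondegenerate rectangles
    standing on the arc of [u]. *)
Definition below (z : nat -> V) (t : R) (k : nat) : bool := y (z k) <= t.

(** Parity of the number of steps of [z], lifted to the angles [al], that cross the
    horizontal line at height [t] to the left of [x]. *)
Definition crossings (z : nat -> V) (al : nat -> R) (p : nat) (x t : R) : bool :=
  \big[addb/false]_(k < p) ((below z t k (+) below z t k.+1) && (al k < x)).

(** Discrete Green formula: [crossings] also counts the crossings of the vertical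
    ray below [(x, t)]. *)
Lemma crossings_by_parts z al p x t : crossings z al p.+1 x t =
  (below z t 0 && (al 0%N < x)) (+)
  \big[addb/false]_(k < p) (below z t k.+1 && ((al k < x) (+) (al k.+1 < x))) (+)
  (below z t p.+1 && (al p < x)).
Proof.
rewrite /crossings; elim: p => [|p IHp].
  rewrite big_ord_recr !big_ord0 /=.
  by case: (below z t 0); case: (below z t 1); case: (al 0%N < x).
rewrite big_ord_recr IHp [in RHS]big_ord_recr /=.
move: (\big[_/_]_(_ < _) _) => B; case: (below z t 0); case: (below z t p.+1); case: (below z t p.+2);
  by case: (al 0%N < x); case: (al p < x); case: (al p.+1 < x); case: B.
Qed.

Lemma crossings_telescope z p t :
  \big[addb/false]_(k < p) (below z t k (+) below z t k.+1) = below z t 0 (+) below z t p.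
Proof.
elim: p => [|p IHp]; first by rewrite big_ord0 addbb.
rewrite big_ord_recr IHp /=.
by case: (below z t 0); case: (below z t p); case: (below z t p.+1).
Qed.

(** A curve in the cover: step [k] runs vertically along the left side of its rectangle, at angle
    [al k], and then the curve moves horizontally from [al k] to [al k.+1] inside one copy of the
    arc of [z k.+1]. *)
Record lifted_ray (z : nat -> V) (al : nat -> R) (zeta : R) : Prop := LiftedRay {
  ray_edge : forall k, exists2 e, joins e (z k) (z k.+1) & exists j : int, al k + j%:~R * eta = a e;
  ray_segment : forall k, segment_in (Ivert (z k.+1)) (al k) (al k.+1);
  ray_angle : al @ \oo --> zeta;
  ray_height : y (z k) @[k --> \oo] --> (1 : R) }.

(** If step [k] crossed level [y u] between the two angles, then just above that level and just to
    the right of [al k] its rectangle would overlap one standing on the arc of [u]. The two edges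
    would coincide and [z] would visit [u]. *)
Lemma crossings_horizontal z al zeta p u x x' : lifted_ray z al zeta ->
  (forall k, z k <> u) -> segment_in (Ivert u) x x' ->
  crossings z al p x (y u) = crossings z al p x' (y u).
Proof.
move=> zray zu.
suff h x1 x2 : x1 <= x2 -> segment_in (Ivert u) x1 x2 ->
    crossings z al p x1 (y u) = crossings z al p x2 (y u).
  by have [/h//|/ltW/h xx'] := leP x x'; move=> /segment_inC/xx'.
move=> {x x'} x12 seg; apply: eq_bigr => k _.
have [sp|//] := boolP (below z (y u) k (+) below z (y u) k.+1); rewrite /=.
apply/idP/idP => [/lt_le_trans|alx2]; first exact.
rewrite ltNge; apply/negP => x1al.
have [e ezz [j ej]] := ray_edge zray k.
have [eloE ehiE] := joins_heights ezz.
have /andP[elo ehi] : ylo e <= y u < yhi e.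
  rewrite eloE ehiE ge_min lt_max; move: sp; rewrite /below.
  by case: leP => ?; case: leP => ?; rewrite ?orbT.
have len0 : 0 < len e by rewrite len_gt0 (le_lt_trans elo).
(* [al k] is a left side, so nearby angles to its right are interior to the rectangle of step
   [k]. *)
have [s] : exists2 s, al k < s < Num.min x2 (al k + len e) & ~ side_angles s.
  by apply: generic_angle; rewrite lt_min alx2 ltrDl.
rewrite lt_min => /andP[als /andP[sx2 sal]] ns.
have [e' ue' se'] : Ivert u s.
  by apply: seg; rewrite min_l// max_r//; apply/andP; split; [exact: ltW (le_lt_trans x1al als)|exact: ltW].
have oe' := open_arc_generic se' ns.
have /out_edgesE[iue' ye'] := ue'.
have oe : open_arc e s by exists j; rewrite -ej ltrD2r als /= addrAC ltrD2r.
have ye'hi : y u < yhi e' by rewrite ye' -len_gt0; exact: open_arc_len oe'.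
have [t /andP[ut]] : exists t, y u < t < Num.min (yhi e) (yhi e').
  exists ((y u + Num.min (yhi e) (yhi e')) / 2); apply/andP; split;
    [apply: (midf_lt _).1|apply: (midf_lt _).2]; by rewrite lt_min ehi.
rewrite lt_min => /andP[te te'].
have ee' : e = e'.
  apply: (rect_overlap (t := t) oe oe'); first by rewrite (le_lt_trans elo ut).
  by rewrite -ye' ut.
move: iue'; rewrite -ee' => -[ue|ue]; case: ezz => -[ea eb].
- by apply: (zu k); rewrite -ea.
- by apply: (zu k.+1); rewrite -ea.
- by apply: (zu k.+1); rewrite -eb.
- by apply: (zu k); rewrite -eb.
Qed.

Lemma segment_separated S u v x : segment_in S u v -> (u < x) (+) (v < x) -> S x.
Proof.
move=> seg uvx; apply: seg; rewrite ge_min le_max.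
by move: uvx; case: (ltP u x); case: (ltP v x) => //= h1 h2; rewrite ?h1 ?h2 ?(ltW h1) ?(ltW h2) ?orbT.
Qed.

Section TwoRays.
Variables (z z' : nat -> V) (al al' : nat -> R) (zeta zeta' : R).
Hypotheses (zray : lifted_ray z al zeta) (z'ray : lifted_ray z' al' zeta').
Hypothesis z0 : z 0%N = z' 0%N.
Hypothesis seg0 : segment_in (Ivert (z 0%N)) (al 0%N) (al' 0%N).

(** By the Green formula the count changes only at vertices whose arc contains [x] and whose height
    is in the range excluded here. The boundary terms at the far ends vanish above [t']; those at
    the start combine into one horizontal move in the arc of the common vertex. *)
Lemma crossings_vertical p p' x t t' : t <= t' ->
  t' < y (z p.+1) -> t' < y (z' p'.+1) ->
  (forall k, Ivert (z k) x -> ~ t < y (z k) <= t') ->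
  (forall k, Ivert (z' k) x -> ~ t < y (z' k) <= t') ->
  crossings z al p.+1 x t (+) crossings z' al' p'.+1 x t =
  crossings z al p.+1 x t' (+) crossings z' al' p'.+1 x t'.
Proof.
move=> tt' zp z'p hz hz'.
have bE (w : nat -> V) k : Ivert (w k) x -> (Ivert (w k) x -> ~ t < y (w k) <= t') ->
    below w t k = below w t' k.
  move=> wx /(_ wx)/negP; rewrite /below negb_and -leNgt => /orP[wt|nwt].
    by rewrite wt (le_trans wt tt').
  by rewrite (negbTE nwt); apply/negbTE; apply: contra nwt => /le_trans; apply.
have sumE (w : nat -> V) be q ze : lifted_ray w be ze ->
    (forall k, Ivert (w k) x -> ~ t < y (w k) <= t') ->
    \big[addb/false]_(k < q) (below w t k.+1 && ((be k < x) (+) (be k.+1 < x))) =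
    \big[addb/false]_(k < q) (below w t' k.+1 && ((be k < x) (+) (be k.+1 < x))).
  move=> wray hw; apply: eq_bigr => k _.
  have [sep|] := boolP ((be k < x) (+) (be k.+1 < x)); last by rewrite !andbF.
  by rewrite (bE w k.+1 _ (hw _))//; exact: (segment_separated (ray_segment wray (k:=k)) sep).
rewrite !crossings_by_parts (sumE _ _ _ _ zray hz) (sumE _ _ _ _ z'ray hz').
have endE (w : nat -> V) q s : s <= t' -> t' < y (w q) -> below w s q = false.
  by move=> st wq; apply/negbTE; rewrite /below -ltNge (le_lt_trans st).
rewrite !(endE z p.+1)// !(endE z' p'.+1)//= !addbF.
have b0 s : below z' s 0 = below z s 0 by rewrite /below z0.
rewrite !b0.
have [sep|] := boolP ((al 0%N < x) (+) (al' 0%N < x)).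
  by rewrite (bE z 0%N _ (hz _))//; exact: (segment_separated seg0 sep).
move: (\big[_/_]_(_ < _) _) (\big[_/_]_(_ < _) _) => A B.
by case: (below z t 0); case: (below z t' 0); case: (al 0%N < x); case: (al' 0%N < x);
  case: A; case: B.
Qed.

(** All crossings of level [t] occur after [n0], hence to the left of [x]; their parity telescopes
    to that of a path from below [t] to above it. In the next lemma they all lie to the right and
    none is counted. *)
Lemma crossings_near_end p x t (n0 : nat) :
  (forall k, (n0 <= k)%N -> al k < x) -> (forall k, (k <= n0)%N -> y (z k) <= t) ->
  t < y (z p) -> crossings z al p x t = true.
Proof.
move=> alx zt tp; rewrite /crossings.
rewrite (eq_bigr (fun k : 'I_p => below z t k (+) below z t k.+1)).
  by rewrite crossings_telescope /below (zt 0%N)// leNgt tp.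
move=> k _; have [kn|nk] := ltnP k n0; last by rewrite alx// andbT.
by rewrite /below !zt// ltnW.
Qed.

Lemma crossings_before_start p x t (n0 : nat) :
  (forall k, (n0 <= k)%N -> x <= al k) -> (forall k, (k <= n0)%N -> y (z k) <= t) ->
  crossings z al p x t = false.
Proof.
move=> alx zt; rewrite /crossings big1// => k _.
have [kn|nk] := ltnP k n0; last by rewrite [al k < x]ltNge alx// andbF.
by rewrite /below !zt// ltnW.
Qed.

End TwoRays.

(** A closed arc is never empty, so some rectangle has its bottom at height [y v], and the
    rectangles cover only heights below 1. *)
Lemma y_lt1 v : y v < 1.
Proof.
have [b [l [/andP[l0 _] Iv]]] := Ivert_arc v.
have [e /out_edgesE[ve ye] eb] : Ivert v b.
  by rewrite Iv; exists 0; rewrite mul0r addr0 lexx lerDl.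
have : [set p : R * R | 0 <= p.2 < 1] (b, y v).
  by rewrite -rect_cover; exists e => //; split => //=; rewrite ye lexx ylo_le_yhi.
by move=> /andP[].
Qed.

Lemma circ_conv_shift s t (k : int) : circ_conv src tgt c P X rho s t ->
  circ_conv src tgt c P X rho s (t + k%:~R * eta).
Proof.
move=> [j sj]; exists (fun n => j n + k).
rewrite (_ : (fun n => _) = (fun n => s n + (j n)%:~R * eta + k%:~R * eta)).
  by apply: cvgD => //; exact: cvg_cst.
by apply/funext => n; rewrite intrD; ring.
Qed.

Variable theta : V -> R.
Hypothesis theta_in : forall v, Ivert v (theta v).

(** The two rays form a lifted bi-infinite path. Followed backwards along [Y], the
    parity of its crossings to the left stays odd, whereas there are none at the root. *)
Lemma rays_separate (z z' Y : nat -> V) (al al' : nat -> R) (zeta zeta' xi : R) :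
  lifted_ray z al zeta -> lifted_ray z' al' zeta' -> z 0%N = z' 0%N ->
  segment_in (Ivert (z 0%N)) (al 0%N) (al' 0%N) ->
  (forall k, 0 < y (z k)) -> (forall k, 0 < y (z' k)) ->
  Y 0%N = rho -> (forall k, nbrs src tgt (Y k) (Y k.+1)) ->
  y (Y k) @[k --> \oo] --> (1 : R) -> circ_conv src tgt c P X rho (theta \o Y) xi ->
  (forall j k, z k <> Y j) -> (forall j k, z' k <> Y j) ->
  ~ zeta < xi < zeta'.
Proof.
move=> zray z'ray z0 seg0 zy z'y Y0 Ynb Yh [j Yj] zY z'Y /andP[zx xz].
have bnd (w : nat -> V) n : exists2 s, s < 1 & forall k, (k <= n)%N -> y (w k) <= s.
  elim: n => [|n [s s1 ws]]; first by exists (y (w 0%N)) => [|k]; [exact: y_lt1|rewrite leqn0 => /eqP ->].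
  exists (Num.max s (y (w n.+1))); first by rewrite gt_max s1 y_lt1.
  move=> k; rewrite leq_eqVlt => /predU1P[->|kn]; first by rewrite le_max lexx orbT.
  by rewrite le_max ws.
have high (w : nat -> V) s : y (w k) @[k --> \oo] --> (1 : R) -> s < 1 ->
    exists n0, forall n, (n0 <= n)%N -> s < y (w n).
  by move=> w1 s1; have /cvgr_gt/(_ _ s1)[n0 _ wn] := w1; exists n0 => n; exact: wn.
set m1 := (zeta + xi) / 2; set m2 := (xi + zeta') / 2.
have zm1 : zeta < m1 by rewrite /m1; lra.
have m1x : m1 < xi by rewrite /m1; lra.
have xm2 : xi < m2 by rewrite /m2; lra.
have m2z : m2 < zeta' by rewrite /m2; lra.
have [n1 aln1] : exists n1, forall k, (n1 <= k)%N -> al k < m1.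
  by have /cvgr_lt/(_ _ zm1)[n1 _ h] := ray_angle zray; exists n1 => n; exact: h.
have [n2 aln2] : exists n2, forall k, (n2 <= k)%N -> m2 < al' k.
  by have /cvgr_gt/(_ _ m2z)[n2 _ h] := ray_angle z'ray; exists n2 => n; exact: h.
have [s1 s11 zs1] := bnd z n1; have [s2 s21 zs2] := bnd z' n2.
(* At time [K] the path [Y] is above all that the rays do before settling on their sides of [m1] and
   [m2], and its angle is between these. The first ray then contributes odd parity and the second
   none. *)
have [K [Kh Kx Kx']] : exists K, [/\ Num.max s1 s2 < y (Y K),
    m1 < theta (Y K) + (j K)%:~R * eta & theta (Y K) + (j K)%:~R * eta < m2].
  have /(high Y)[//|n3 h3] : Num.max s1 s2 < 1 by rewrite gt_max s11.
  have /cvgr_gt/(_ _ m1x)[n4 _ h4] := Yj; have /cvgr_lt/(_ _ xm2)[n5 _ h5] := Yj.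
  exists (maxn n3 (maxn n4 n5)); split.
  - by apply: h3; rewrite leq_maxl.
  - by apply: h4; rewrite /= !leq_max leqnn !orbT.
  - by apply: h5; rewrite /= !leq_max leqnn !orbT.
(* The rays are truncated above every height taken by [Y] up to time [K], so that their far ends do
   not contribute. *)
have [s3 s31 Ys3] := bnd Y K.
have [p zp] : exists p, s3 < y (z p.+1).
  by have [n0 /(_ n0.+1 (leqnSn _)) h] := high z _ (ray_height zray) s31; exists n0.
have [p' z'p] : exists p, s3 < y (z' p.+1).
  by have [n0 /(_ n0.+1 (leqnSn _)) h] := high z' _ (ray_height z'ray) s31; exists n0.
move: Kh; rewrite gt_max => /andP[sK1 sK2].
pose tot x t := crossings z al p.+1 x t (+) crossings z' al' p'.+1 x t.
have main k : (k <= K)%N -> exists2 x, Ivert (Y (K - k)%N) x & tot x (y (Y (K - k)%N)).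
  elim: k => [_|k IHk kK].
    rewrite subn0; exists (theta (Y K) + (j K)%:~R * eta); first exact: Ivert_shift.
    rewrite /tot (@crossings_near_end _ _ _ _ _ n1).
    - rewrite (@crossings_before_start _ _ _ _ _ n2)//.
        by move=> k /aln2 h; exact/ltW/(lt_trans Kx').
      by move=> k /zs2 h; exact/ltW/(le_lt_trans h).
    - by move=> k /aln1 h; exact: lt_trans h Kx.
    - by move=> k /zs1 h; exact/ltW/(le_lt_trans h).
    - by apply: le_lt_trans zp; exact: Ys3.
  have [x Ix tx] := IHk (ltnW kK); rewrite subnS.
  have Kk : (K - k)%N = (K - k.+1).+1 by rewrite subnSK.
  move: Ix tx; rewrite Kk /=; set i := (K - k.+1)%N => Ix tx.
  have [e eY] := Ynb i.
  have eu : inc (Y i) e by case: eY => -[]; [left|right].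
  have eu' : inc (Y i.+1) e by case: eY => -[]; [right|left].
  have hor u x1 x2 (m : nat) : Y m = u -> segment_in (Ivert u) x1 x2 -> tot x1 (y u) = tot x2 (y u).
    move=> Ym sg; rewrite /tot (crossings_horizontal p.+1 zray _ sg); last by rewrite -Ym.
    by rewrite (crossings_horizontal p'.+1 z'ray _ sg)// -Ym.
  (* To pass from [Y i.+1] to [Y i], move horizontally to an angle [g] of their edge and then along
     its rectangle. The angle is generic unless the rectangle is degenerate, in which case the two
     heights agree. *)
  have [g [ge gn]] : exists g, Iedge e g /\ (0 < len e -> ~ side_angles g).
    have le0 : 0 <= len e by rewrite /Defs.len mulr_ge0 ?subr_ge0 ?ylo_le_yhi// ltW.
    have [l0|l0] := ltP 0 (len e).
      have /generic_angle[g /andP[ag ga] gn] : a e < a e + len e by rewrite ltrDl.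
      by exists g; split => //; exists 0; rewrite mul0r addr0 !ltW.
    by exists (a e); split => //; exists 0; rewrite mul0r addr0 lexx lerDl.
  have [q qseg] := Ivert_component Ix (Iedge_incident eu' ge).
  set g' := g + q%:~R * eta in qseg.
  have Ig' : Ivert (Y i) g' by apply/Ivert_shift/(Iedge_incident eu).
  exists g' => //; rewrite (hor _ _ _ i.+1 erefl qseg) in tx.
  have [eloE ehiE] := joins_heights eY.
  have [l0|l0] := ltP 0 (len e); last first.
    have : ylo e = yhi e.
      apply/eqP; rewrite eq_le ylo_le_yhi leNgt -len_gt0 -leNgt; exact: l0.
    rewrite eloE ehiE => yE; rewrite (_ : y (Y i) = y (Y i.+1))//.
    by move: yE; case: leP.
  have og' : open_arc e g'.
    by apply: open_arc_generic; [exact: carc_shift|move/side_angles_shift; exact: gn].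
  (* Such a vertex would have an incoming edge whose rectangle overlaps that of [e], so the ray
     would meet [Y]. Positive heights exclude [rho], where arcs are not described by incoming
     edges. *)
  have free (w : nat -> V) n : (forall k, 0 < y (w k)) -> (forall j k, w k <> Y j) ->
      Ivert (w n) g' -> ~ ylo e < y (w n) <= yhi e.
    move=> w0 wY; rewrite Ivert_in; last by move=> wr; move: (w0 n); rewrite wr y_rho ltxx.
    move=> [e1 /in_edgesE[we1 ye1] g'e1] /andP[lw wh].
    have oe1 : open_arc e1 g' by apply: open_arc_generic => // /side_angles_shift; exact: gn.
    have l1 : ylo e1 < y (w n) by rewrite ye1 -len_gt0; exact: open_arc_len oe1.
    have [t /andP[t1 t2]] : exists t, Num.max (ylo e) (ylo e1) < t < y (w n).
      exists ((Num.max (ylo e) (ylo e1) + y (w n)) / 2); apply/andP; split;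
        [apply: (midf_lt _).1|apply: (midf_lt _).2]; by rewrite gt_max lw.
    move: t1; rewrite gt_max => /andP[t1 t1'].
    have ee1 : e = e1.
      apply: (rect_overlap (t := t) og' oe1); first by rewrite t1 (lt_le_trans t2).
      by rewrite t1' -ye1.
    move: we1; rewrite -ee1 => -[we|we]; case: eY => -[ea eb].
    - by apply: (wY i n); rewrite -ea.
    - by apply: (wY i.+1 n); rewrite -ea.
    - by apply: (wY i.+1 n); rewrite -eb.
    - by apply: (wY i n); rewrite -eb.
  have ver : tot g' (ylo e) = tot g' (yhi e).
    have h3 : yhi e <= s3.
      by rewrite ehiE ge_max !Ys3 ?leq_subr// /i subnSK// leq_subr.
    apply: (crossings_vertical zray z'ray z0 seg0 (ylo_le_yhi e)).
    - exact: le_lt_trans zp.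
    - exact: le_lt_trans z'p.
    - by move=> n; exact: free.
    - by move=> n; exact: free.
  move: ver tx; rewrite eloE ehiE; case: leP => // _; by move=> ->.
(* Back at the root the level is 0, and no vertex of the rays is at or below it: the parity is even,
   a contradiction. *)
have [x _] := main K (leqnn _); rewrite subnn Y0 y_rho /tot.
have none (w : nat -> V) be q : (forall k, 0 < y (w k)) -> crossings w be q x 0 = false.
  by move=> w0; rewrite /crossings big1// => k _; rewrite /below !leNgt !w0.
by rewrite !none.
Qed.

Definition arc_start v : R := projT1 (cid (Ivert_arc v)).
Definition arc_width v : R := projT1 (cid (projT2 (cid (Ivert_arc v)))).

Lemma IvertE v : Ivert v = carc (arc_start v) (arc_width v).
Proof. by rewrite /arc_width /arc_start; case: cid => b ex /=; case: cid => l /= []. Qed.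

Lemma arc_width_itv v : 0 <= arc_width v <= eta.
Proof. by rewrite /arc_width; case: cid => b ex /=; case: cid => l /= []. Qed.

Lemma Ivert_near v x x' : Ivert v x -> Ivert v x' ->
  exists k : int, `|x' + k%:~R * eta - x| <= arc_width v.
Proof.
rewrite IvertE => -[i /andP[xi ix]] [j /andP[xj jx]]; exists (j - i).
by rewrite intrB ler_norml; lra.
Qed.

(** Consecutive copies of the lifted arc are separated by gaps of length [eta - arc_width v]. *)
Lemma Ivert_close_segment v x x' : Ivert v x -> Ivert v x' ->
  `|x - x'| < eta - arc_width v -> segment_in (Ivert v) x x'.
Proof.
rewrite IvertE => -[i /andP[xi ix]] [j /andP[xj jx]]; rewrite ltr_norml => /andP[h1 h2].
have ij : i = j.
  apply/eqP; rewrite eq_le; apply/andP; split; rewrite leNgt; apply/negP;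
    rewrite -lezD1 -(ler_int R) intrD => h; have := ler_wpM2r (ltW eta_gt0) h; lra.
move=> s; rewrite ge_min le_max => /andP[/orP[] s1 /orP[] s2]; exists i;
  rewrite -ij in xj jx; lra.
Qed.

(** The fundamental domain may cut the arc in two, but one of the two pieces has at least half of
    its length. *)
Lemma Ilength_ge v : ((arc_width v / 2)%:E <= Ilength src tgt c P X rho a v)%E.
Proof.
have /andP[l0 leta] := arc_width_itv v; rewrite /Ilength IvertE.
set b := arc_start v; set l := arc_width v.
have [k /andP[bk kb]] : exists k : int, 0 <= b - k%:~R * eta < eta.
  exists (Num.floor (b / eta)).
  have := floor_itv (b / eta).
  by rewrite ler_pdivlMr// ltr_pdivrMr// intrD => /andP[]; lra.
have sub (u : R) : 0 <= u -> u + l / 2 <= eta -> (forall x, u <= x < u + l / 2 -> carc b l x) ->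
    ((l / 2)%:E <= lebesgue_measure (carc b l `&` (`[0%R, eta[ : set R)))%E.
  move=> u0 ul ux.
  have -> : (l / 2)%:E = lebesgue_measure (`[u, (u + l / 2)[ : set R).
    rewrite lebesgue_measure_itv /= lte_fin ltrDl.
    case: ltP => [_|l2]; first by rewrite -EFinD addrAC subrr add0r.
    by congr EFin; apply/eqP; rewrite eq_le l2 divr_ge0.
  apply: le_outer_measure => x /=; rewrite !in_itv /= => xu; split; first exact: ux.
  by case/andP: xu => xu xl; rewrite (le_trans u0 xu) (lt_le_trans xl).
have [bl|bl] := leP (b - k%:~R * eta + l / 2) eta.
  apply: (sub (b - k%:~R * eta)) => // x /andP[x1 x2]; exists k; move: l0; rewrite -/l; lra.
apply: (sub 0) => //; first by move: leta l0; rewrite -/l; lra.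
move=> x /andP[x1 x2]; exists (k + 1); rewrite intrD; move: l0; rewrite -/l; lra.
Qed.

(** An arc of width 0 lifts to a translate of the lattice, which contains no interval. Applied to
    the root, this prevents infinitely many returns once the lengths tend to 0. *)
Lemma arc_width_gt0 v e : out_edges v e -> 0 < len e -> 0 < arc_width v.
Proof.
move=> ve l0; have /andP[w0 weta] := arc_width_itv v.
rewrite lt_neqAle w0 andbT; apply/negP => /eqP w.
have hx s : 0 <= s <= len e -> exists k : int, a e + s + k%:~R * eta = arc_start v.
  move=> /andP[s0 sl]; have : Ivert v (a e + s).
    by exists e => //; exists 0; rewrite mul0r addr0 lerDl s0 lerD2l.
  by rewrite IvertE -w => -[k]; rewrite addr0 => /le_anti ->; exists k.
pose s := Num.min (len e) (eta / 2).
have s0 : 0 < s by rewrite lt_min l0 divr_gt0.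
have [|k hk] := hx s; first by rewrite ltW//= ge_min lexx.
have [|j hj] := hx 0; first by rewrite lexx ltW.
have sk : s = (j - k)%:~R * eta by rewrite intrB; lra.
have seta : s < eta by rewrite gt_min; apply/orP; right; move: eta_gt0; lra.
have jk0 : (0 < j - k)%R.
  by rewrite -(ltr_int R) -(pmulr_lgt0 _ eta_gt0) -sk.
have : (j - k < 1)%R by rewrite -(ltr_int R) -(ltr_pM2r eta_gt0) -sk mul1r.
by rewrite -lezD1 add0r in jk0; rewrite ltNge jk0.
Qed.

Lemma lifted_ray_shift z al zeta (k : int) : lifted_ray z al zeta ->
  lifted_ray z (fun n => al n + k%:~R * eta) (zeta + k%:~R * eta).
Proof.
case=> edge seg lim hgt; split => //.
- move=> n; have [e je [j ej]] := edge n; exists e => //; exists (j - k).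
  by rewrite intrB -ej; ring.
- move=> n x hx; rewrite (_ : x = x + (- k)%:~R * eta + k%:~R * eta); last by rewrite mulrNz; ring.
  apply: Ivert_shift; apply: seg; move: hx; rewrite mulrNz !ge_min !le_max => /andP[].
  by move=> /orP[] h1 /orP[] h2; apply/andP; split; apply/orP; [left|left|left|right|right|left|right|right]; lra.
- by apply: cvgD => //; exact: cvg_cst.
Qed.

(** Take the left end of each edge, lifted to within one arc width of the lifted [theta (x n)].
    Vanishing lengths give the same limit, and eventually consecutive angles lie in one copy of the
    arc between them. *)
Lemma path_tail_ray (x : nat -> V) (t : R) : (forall k, nbrs src tgt (x k) (x k.+1)) ->
  circ_conv src tgt c P X rho (theta \o x) t ->
  Ilength src tgt c P X rho a (x n) @[n --> \oo] --> 0%E ->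
  y (x n) @[n --> \oo] --> (1 : R) ->
  exists al n0, forall n, (n0 <= n)%N ->
    Ivert (x n) (al n) /\ lifted_ray (pshift n x) (fun k => al (n + k)%N) t.
Proof.
move=> xnb [j xj] xlen xh.
have /choice[e xe] : forall n, exists e, joins e (x n) (x n.+1) by move=> n; exact: xnb.
have inl n : inc (x n) (e n) by case: (xe n) => -[]; [left|right].
have inr n : inc (x n.+1) (e n) by case: (xe n) => -[]; [right|left].
have ae n : Iedge (e n) (a (e n)).
  by exists 0; rewrite mul0r addr0 lexx lerDl /Defs.len mulr_ge0 ?subr_ge0 ?ylo_le_yhi// ltW.
pose th n := theta (x n) + (j n)%:~R * eta.
have /choice[k thk] : forall n, exists k : int, `|a (e n) + k%:~R * eta - th n| <= arc_width (x n).
  by move=> n; apply: Ivert_near; [exact: Ivert_shift|exact: (Iedge_incident (inl n))].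
pose al n := a (e n) + (k n)%:~R * eta.
have small eps : 0 < eps -> exists n0, forall n, (n0 <= n)%N ->
    arc_width (x n) < eps /\ `|th n - t| < eps.
  move=> e0.
  have /fine_cvgP[fin /cvgr_lt] := xlen; have e2 : 0 < eps / 2 by rewrite divr_gt0.
  move=> /(_ _ e2)[n1 _ h1]; have [n2 _ h2] := fin.
  have /cvgr_dist_lt/(_ _ e0)[n3 _ h3] := xj.
  exists (maxn n1 (maxn n2 n3)) => n; rewrite !geq_max => /and3P[n1n n2n n3n]; split.
    have := Ilength_ge (x n); have := h1 _ n1n; have := h2 _ n2n => /= fn.
    by rewrite -(fineK fn) lee_fin /= => u v; lra.
  by rewrite distrC; exact: h3.
(* Four errors below [eta / 8] keep consecutive angles within [eta / 2], less than the gap left by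
   an arc narrower than [eta / 8]. *)
have [n0 hn0] := small (eta / 8) (divr_gt0 eta_gt0 (ltr0Sn _ _)).
have allim : al @ \oo --> t.
  apply/cvgrPdist_lt => eps e0; have [n1 h1] := small _ (divr_gt0 e0 (ltr0Sn _ 1)).
  exists n1 => // n /= /h1[w1 w2]; rewrite distrC.
  rewrite (_ : al n - t = (al n - th n) + (th n - t)); last by ring.
  rewrite (le_lt_trans (ler_normD _ _))// (splitr eps).
  by rewrite ltrD// (le_lt_trans (thk n)).
exists al, n0 => n nn.
have sh (u : nat -> R) (l : R) : u @ \oo --> l -> (fun k => u (n + k)%N) @ \oo --> l.
  move=> ul; rewrite (_ : (fun k => _) = [sequence u (k + n)%N]_k) ?cvg_shiftn//.
  by apply/funext => m; rewrite addnC.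
split; first by apply/Ivert_shift/(Iedge_incident (inl n)).
split.
- move=> m; exists (e (n + m)%N); first by rewrite /pshift addnS.
  by exists (- k (n + m)%N); rewrite /pshift /al mulrNz; ring.
- move=> m; rewrite /pshift addnS; set i := (n + m)%N.
  have ni : (n0 <= i)%N by rewrite (leq_trans nn)// leq_addr.
  apply: Ivert_close_segment.
  + exact/Ivert_shift/(Iedge_incident (inr i)).
  + exact/Ivert_shift/(Iedge_incident (inl i.+1)).
  have [w1 t1] := hn0 _ ni; have [w2 t2] := hn0 _ (leqW ni).
  have := thk i; have := thk i.+1; rewrite -/(al i) -/(al i.+1).
  move: t1 t2; rewrite !ltr_norml !ler_norml; lra.
- exact: sh.
- exact: (@sh (fun k => y (x k)) _ xh).
Qed.

End Tiling.

(** * The limit angle has no atoms *)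

Section Height.
Variables (R : realType) (V E : choiceType) (src tgt : E -> V) (c : E -> R).
Hypothesis net : is_network src tgt c.
Hypothesis inc_n0 : forall u, incident src tgt u !=set0.
Variables (d : measure_display) (Om : measurableType d)
  (P : V -> probability Om R) (X : nat -> Om -> V).
Hypothesis rw : is_random_walk src tgt c P X.
Variable vs : nat -> V.
Hypothesis vs_surj : forall v, exists n, vs n = v.
Variable rho : V.

Local Notation cp := (cond_pair src tgt c).
Local Notation nb := (nbrs src tgt).
Local Notation step := (walk_step src tgt c).
Local Notation isteps := (walk_steps src tgt c).
Local Notation T := (path_space rho).
Local Notation trajectory := (trajectory X rho).
Local Notation pr := (path_prob P X).
Local Notation y := (yv P X rho).
Local Notation eta := (eta_cyl src tgt c P X rho).

Definition avoids : set T := [set z | forall n, z n <> rho].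

Lemma measurable_avoids : measurable avoids.
Proof.
rewrite (_ : avoids = \bigcap_n [set z | (~` [set rho]) (z n)]).
  by apply: bigcapT_measurable => n; exact: (measurable_coord rho vs_surj).
by apply/seteqP; split => [z zn n _|z zn n]; [exact: zn|exact: (zn n I)].
Qed.

Lemma heightE v : y v = pr v avoids.
Proof. by []. Qed.

Lemma height_ge0 v : 0 <= y v.
Proof. exact: fine_ge0. Qed.

Lemma height_root : y rho = 0.
Proof.
rewrite heightE -(pr0 P X rho rho); apply: (eq_pr rw) => //; first exact: measurable_avoids.
by apply: filterS (ae_start rw vs_surj rho rho) => w X0; split => // /(_ 0%N); rewrite /trajectory X0.
Qed.

Lemma height_step v : v <> rho -> y v = step y v.
Proof.
move=> vrho; rewrite -(markov1 net inc_n0 rw vs_surj v measurable_avoids) heightE.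
apply: (eq_pr rw); first exact: measurable_avoids.
  exact: (measurable_pshift vs_surj _ measurable_avoids).
apply: filterS (ae_start rw vs_surj rho v) => w X0; split => [wn n|wn [|n]]; first exact: wn.
  by rewrite /trajectory X0.
exact: (wn n).
Qed.

Lemma height_le_step v : y v <= step y v.
Proof.
have [->|/eqP vr] := eqVneq v rho; last by rewrite -height_step.
by rewrite height_root; apply: (step_ge0 net inc_n0) => u; exact: height_ge0.
Qed.

(** If [eta] were 0, then [y] would be harmonic at the root too; being nonnegative and 0 there, it
    would vanish everywhere by the minimum principle. *)
Lemma eta_cyl_gt0 : (exists v, 0 < y v) -> 0 < eta.
Proof.
move=> [v yv0]; rewrite lt_neqAle; apply/andP; split; last first.
  by apply: fsumr_ge0 => u _; apply: mulr_ge0; [exact: (cond_pair_ge0 net)|exact: height_ge0].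
apply/negP => /eqP eta0.
have step0 : step y rho = 0 by rewrite stepE// -/eta_cyl -[X in X / _]eta0 mul0r.
have harm u : step y u = y u.
  by have [->|/eqP ur] := eqVneq u rho; [rewrite step0 height_root|rewrite -height_step].
have [_ _ /(_ rho v)[n [x [x0 xn xS]]]] := net.
move: yv0; rewrite -xn; suff -> : y (x n) = 0 by rewrite ltxx.
suff : forall k, (k <= n)%N -> y (x k) = 0 by apply.
elim=> [_|k IHk kn]; first by rewrite x0 height_root.
have := height_ge0 (x k.+1); rewrite le_eqVlt => /predU1P[//|yk].
have := step_gt0 net inc_n0 height_ge0 (xS _ kn) yk.
by rewrite harm IHk ?ltxx// ltnW.
Qed.

(** [1 - y] is a nonnegative supermartingale whose mean at time [n] is the probability of a visit to
    the root from time [n] on, which tends to 0 by transience. *)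
Lemma height_cvg1 : {ae P rho, forall w, exists N, forall n, (N <= n)%N -> X n w <> rho} ->
  {ae P rho, forall w, y (X n w) @[n --> \oo] --> (1 : R)}.
Proof.
move=> trans.
pose B (n : nat) : set T := pshift n @^-1` avoids.
have mB n : measurable (B n) by apply: (measurable_pshift vs_surj); exact: measurable_avoids.
have ndB : nondecreasing_seq B.
  by move=> m n mn; apply/subsetPset => z zm k; move: (zm (n - m + k)%N); rewrite /pshift addnA subnKC.
have hc := nondecreasing_cvg_pr rw (v := rho) mB ndB.
have : pr rho (\bigcup_n B n) = 1.
  rewrite -(prT P X rho rho); apply: (eq_pr rw) => //; first exact: bigcupT_measurable.
  apply: filterS trans => w [N wN]; split => // _; exists N => // k.
  by apply: wN; rewrite leq_addr.
move=> B1; rewrite B1 in hc.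
have : {ae P rho, forall w, 1 - y (X n w) @[n --> \oo] --> (0 : R)}.
  apply: (@supermartingale_cvg0 _ _ _ _ _ _ net inc_n0 _ _ _ _ rw _ vs_surj rho (fun u => 1 - y u)).
  - by move=> u; rewrite subr_ge0 heightE (pr_le1 rw)//; exact: measurable_avoids.
  - by move=> u; rewrite (stepB net)// (step_cst net inc_n0) lerB// height_le_step.
  - rewrite -(subrr (1 : R)).
    rewrite (_ : (fun n => _) = (fun n => 1 - pr rho (B n))).
      by apply: cvgB => //; exact: cvg_cst.
    apply/funext => n; rewrite (markov_pshift net inc_n0 rw vs_surj)//; last exact: measurable_avoids.
    rewrite -[in RHS](isteps_cst net inc_n0 n 1 rho) -mulN1r -(istepsZ net) -(istepsD net).
    by congr (walk_steps _ _ _ _ _); apply/funext => u; rewrite mulN1r.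
apply: filterS => w h.
rewrite (_ : (fun n => _) = (fun n => 1 - (1 - y (X n w)))); last by apply/funext => n; ring.
by rewrite -[X in _ --> X](subr0 (1 : R)); apply: cvgB => //; exact: cvg_cst.
Qed.

End Height.

(** * The walk killed on passing a fixed height, and its Green function *)

Section KilledWalk.
Variables (R : realType) (V E : choiceType) (src tgt : E -> V) (c : E -> R).
Hypothesis net : is_network src tgt c.
Hypothesis inc_n0 : forall u, incident src tgt u !=set0.
Variables (d : measure_display) (Om : measurableType d)
  (P : V -> probability Om R) (X : nat -> Om -> V).
Hypothesis rw : is_random_walk src tgt c P X.
Variable vs : nat -> V.
Hypothesis vs_surj : forall v, exists n, vs n = v.
Variable rho : V.

Local Notation cp := (cond_pair src tgt c).
Local Notation cv := (cond_vert src tgt c).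
Local Notation p := (trans_prob src tgt c).
Local Notation nb := (nbrs src tgt).
Local Notation step := (walk_step src tgt c).
Local Notation T := (path_space rho).
Local Notation pr := (path_prob P X).
Local Notation y := (yv P X rho).
Local Notation eta := (eta_cyl src tgt c P X rho).

Hypothesis eta_gt0 : 0 < eta.
Variable t : R.
Hypothesis t_gt0 : 0 < t.

Definition is_low (w : V) : bool := y w < t.

Local Notation low := is_low.

(** Total conductance at [w] of the network cut at height [t], where the part of
    an edge below that height has a proportionally larger conductance. *)
Definition cut_cond (w : V) : R :=
  \sum_(w' \in nb w) cp w w' * (if low w' then 1 else (y w' - y w) / (t - y w)).

(** The walk on the cut network, stopped when it reaches height [t], is the original
    walk killed at [w] with probability [1 - survival w]. *)
Definition survival_prob (w : V) : R := if low w then cv w / cut_cond w else 0.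

Local Notation survival := survival_prob.

(** The start plus the expected arrivals: along an edge from a low [w'] these are its conductance
    times [(t - y w') / eta]. In this form the Green function also covers vertices above height
    [t]. *)
Definition green_bound (w : V) : R := (w == rho)%:R +
  (\sum_(w' \in nb w) cp w w' * (if low w' then t - y w' else 0)) / eta.

Local Notation green := green_bound.

(** The probability that the walk from [rho] is at [w] at time [n], having survived at all earlier
    vertices; survival at [w] is tested on leaving it. *)
Fixpoint alive (n : nat) (w : V) : R :=
  if n is m.+1 then \sum_(w' \in nb w) alive m w' * survival w' * p w' w
  else (w == rho)%:R.

Let y_ge0 := height_ge0 P X rho.
Let cv_gt0 := cond_vert_gt0 net inc_n0.
Let cp_ge0 := cond_pair_ge0 net.

Lemma low_root : low rho.
Proof. by rewrite /is_low (height_root rw vs_surj). Qed.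

Lemma le_cut_cond w : low w -> cv w <= cut_cond w.
Proof.
rewrite /is_low => lw; have fn := finite_nbrs net w.
rewrite cond_vertE// /cut_cond !fsbig_finite//=; apply: ler_sum => w' _.
rewrite ler_peMr//; case: ifPn => // /negP; rewrite /is_low => /negP; rewrite -leNgt => tw.
by rewrite ler_pdivlMr ?subr_gt0// mul1r lerD2r.
Qed.

Lemma cut_cond_flow w : low w -> (t - y w) * cut_cond w =
  \sum_(w' \in nb w) cp w w' * (if low w' then t - y w else y w' - y w).
Proof.
move=> lw; have fn := finite_nbrs net w.
rewrite /cut_cond !fsbig_finite//= mulr_sumr; apply: eq_bigr => w' _.
case: ifP => _; first by rewrite mulr1 mulrC.
by rewrite mulrCA [_ * (_ / _)]mulrC mulfVK// gt_eqF// subr_gt0.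
Qed.

Lemma green_low w : low w -> green w = (t - y w) * cut_cond w / eta.
Proof.
move=> lw; have fn := finite_nbrs net w.
(* The net flow of [y] is [eta] at the root, by definition of [eta], and 0 elsewhere, by
   harmonicity. *)
have flux : \sum_(w' \in nb w) cp w w' * (y w' - y w) = (w == rho)%:R * eta.
  transitivity (cv w * (step y w - y w)).
    rewrite stepE// mulrBr mulrCA divff ?mulr1; last by rewrite gt_eqF.
    rewrite [X in _ - X * _]cond_vertE// !fsbig_finite//= mulr_suml -sumrB.
    by apply: eq_bigr => w' _; rewrite mulrBr.
  have [->|/eqP wr] := eqVneq w rho; last first.
    by rewrite -(height_step net inc_n0 rw vs_surj wr) subrr mulr0 mul0r.
  rewrite (height_root rw vs_surj) subr0 mul1r stepE// mulrCA divff ?mulr1// gt_eqF//.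
rewrite cut_cond_flow// /green_bound -[X in X + _](mulfK (lt0r_neq0 eta_gt0)) -flux -mulrDl.
congr (_ / _); rewrite !fsbig_finite//= -big_split; apply: eq_bigr => w' _ /=.
by rewrite -mulrDr; congr (_ * _); case: ifP => _; ring.
Qed.

Lemma survival_ge0 w : 0 <= survival w.
Proof.
rewrite /survival_prob; case: ifPn => // lw.
by rewrite divr_ge0 ?(ltW (cv_gt0 w))// (le_trans (ltW (cv_gt0 w)))// le_cut_cond.
Qed.

Lemma survival_le1 w : survival w <= 1.
Proof.
rewrite /survival_prob; case: ifPn => // lw.
by rewrite ler_pdivrMr ?mul1r ?le_cut_cond// (lt_le_trans (cv_gt0 w))// le_cut_cond.
Qed.

Lemma survival_deep w : low w -> (forall w', nb w w' -> low w') -> survival w = 1.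
Proof.
move=> lw nlow; rewrite /survival_prob lw (_ : cut_cond w = cv w) ?divff ?gt_eqF//.
rewrite cond_vertE// /cut_cond; apply: eq_fsbigr => w'.
by rewrite inE => /nlow ->; rewrite mulr1.
Qed.

Lemma alive_ge0 n w : 0 <= alive n w.
Proof.
elim: n w => [|n IHn] w; first exact: ler0n.
apply: fsumr_ge0 => w' _; apply: mulr_ge0; last exact: (trans_prob_ge0 net).
by apply: mulr_ge0 => //; exact: survival_ge0.
Qed.

(** [green] solves the recursion for the expected number of visits, and partial sums of visits stay
    below any nonnegative solution. *)
Lemma sum_alive_le_green N w : \sum_(n < N) alive n w <= green w.
Proof.
elim: N w => [|N IHN] w.
  rewrite big_ord0 /green_bound addr_ge0 ?ler0n// divr_ge0 ?(ltW eta_gt0)//.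
  apply: fsumr_ge0 => w' _; rewrite mulr_ge0//.
  by case: ifPn => //; rewrite /is_low => /ltW; rewrite subr_ge0.
have fn := finite_nbrs net w.
rewrite big_ord_recl /green_bound lerD2l.
under eq_bigr do rewrite /= fsbig_finite//=.
rewrite exchange_big fsbig_finite//= mulr_suml; apply: ler_sum => w' _.
under eq_bigr do rewrite -mulrA.
rewrite -mulr_suml; apply: (@le_trans _ _ (green w' * (survival w' * p w' w))).
  by rewrite ler_wpM2r// mulr_ge0 ?survival_ge0//; exact: (trans_prob_ge0 net).
rewrite /survival_prob; case: ifPn => lw; last by rewrite mul0r !mulr0 mul0r.
rewrite green_low// /trans_prob (cond_pairC _ _ _ w').
have ct0 : 0 < cut_cond w' by rewrite (lt_le_trans (cv_gt0 w'))// le_cut_cond.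
have cv0 := cv_gt0 w'.
rewrite le_eqVlt; apply/orP; left; apply/eqP; field.
by rewrite !gt_eqF.
Qed.

Definition root_ball (n : nat) : set V :=
  iter n (fun B => B `|` \bigcup_(u in B) nb u) [set rho].

Lemma finite_root_ball n : finite_set (root_ball n).
Proof.
elim: n => [|n IHn]; first exact: finite_set1.
by rewrite finite_setU; split => //; apply: bigcup_finite => // u _; exact: (finite_nbrs net).
Qed.

Lemma sub_root_ball m n : (m <= n)%N -> root_ball m `<=` root_ball n.
Proof.
move=> /subnKC <-; elim: (n - m)%N => [|k IHk]; first by rewrite addn0.
by rewrite addnS => w /IHk ?; left.
Qed.

Lemma root_ball_nbrs n u v : root_ball n u -> nb u v -> root_ball n.+1 v.
Proof. by move=> nu uv; right; exists u. Qed.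

Lemma alive_out n w : ~ root_ball n w -> alive n w = 0.
Proof.
elim: n w => [|n IHn] w nw /=; first by case: eqP nw => // ->; case.
apply: fsbig1 => w' ww'; rewrite IHn ?mul0r// => nw'; apply: nw.
by apply: root_ball_nbrs nw' _; exact: nbrs_sym.
Qed.

Lemma trans_prob_eq0 u v : ~ nb u v -> p u v = 0.
Proof. by move=> uv; rewrite /trans_prob cond_pair_eq0// mul0r. Qed.

(** Forward evolution of the law is adjoint to backward averaging of functions; [D] only makes the
    sums finite, as [alive n] lives on a finite ball. *)
Lemma alive_step n (D : set V) (g : V -> R) : finite_set D -> root_ball n.+1 `<=` D ->
  \sum_(w \in D) alive n.+1 w * g w =
  \sum_(w \in D) alive n w * (survival w * step g w).
Proof.
move=> fD nD.
have aliveE w : alive n.+1 w = \sum_(w' \in D) alive n w' * survival w' * p w' w.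
  rewrite /= (@fsbig_widen _ _ _ _ (nb w) (nb w `|` D)); last 2 first.
  - exact: subsetUl.
  - by move=> w' [_ nw'] /=; rewrite trans_prob_eq0 ?mulr0// => /nbrs_sym.
  rewrite [RHS](@fsbig_widen _ _ _ _ D (nb w `|` D)); last 2 first.
  - exact: subsetUr.
  - move=> w' [_ nw'] /=; rewrite alive_out ?mul0r// => w'n; apply: nw'; apply: nD.
    exact: sub_root_ball w'n.
  by [].
transitivity (\sum_(w \in D) \sum_(w' \in D) alive n w' * survival w' * p w' w * g w).
  apply: eq_fsbigr => w _; rewrite aliveE !fsbig_finite//= mulr_suml.
  by apply: eq_bigr.
rewrite exchange_fsbig//; apply: eq_fsbigr => w' _.
have [w'n|w'n] := pselect (root_ball n w'); last first.
  by rewrite alive_out// [RHS]mul0r fsbig1// => w _; rewrite !mul0r.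
rewrite mulrA /walk_step (@fsbig_widen _ _ _ _ (nb w') D); last 2 first.
- by move=> w w'w; apply: nD; exact: root_ball_nbrs w'w.
- by move=> w [_ nw] /=; rewrite trans_prob_eq0 ?mul0r.
by rewrite !fsbig_finite//= mulr_sumr; apply: eq_bigr => w _; rewrite mulrA.
Qed.

Variable S : set V.

Definition stays (j : nat) : set T := [set z | forall n, (j <= n)%N -> S (z n)].

Lemma measurable_stays j : measurable (stays j).
Proof.
rewrite (_ : stays j = \bigcap_n [set z | ((j <= n)%N -> S (z n))]).
  apply: bigcapT_measurable => n.
  exact: (measurable_coord rho vs_surj n [set v | (j <= n)%N -> S v]).
by apply/seteqP; split => [z zn n _|z zn n]; [exact: zn|exact: (zn n I)].
Qed.

Lemma stays_step j v : pr v (stays j.+1) = step (fun u => pr u (stays j)) v.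
Proof.
rewrite -(markov1 net inc_n0 rw vs_surj); last exact: measurable_stays.
congr (path_prob _ _ _ _); apply/seteqP; split => z zS n; first by move=> jn; exact: zS.
by case: n => // n; exact: zS.
Qed.

Lemma pr_stays0_le1S v : pr v (stays 0) <= (v \in S)%:R.
Proof.
case: (boolP (v \in S)) => [_|/negP vS]; first exact: (pr_le1 rw _ (measurable_stays _)).
rewrite mulr0n -(pr0 P X rho v) le_eqVlt; apply/orP; left; apply/eqP; apply: (eq_pr rw) => //.
  exact: measurable_stays.
apply: filterS (ae_start rw vs_surj rho v) => w X0; split => // /(_ 0%N isT).
by rewrite /trajectory X0 => /mem_set.
Qed.

Definition remains_low (m : nat) : set T := [set z | forall k, (k < m)%N -> low (z k)].

Lemma measurable_remains_low m : measurable (remains_low m).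
Proof.
apply: (@measurable_depends _ rho _ vs_surj m) => z z' zz' zl k km.
by rewrite -zz' ?(ltnW km)//; exact: zl.
Qed.

Lemma remains_low_step m v : survival v * step (fun u => pr u (remains_low m)) v <=
  pr v (remains_low m.+1).
Proof.
rewrite -(markov1 net inc_n0 rw vs_surj); last exact: measurable_remains_low.
have [lv|lv] := boolP (low v); last by rewrite /survival_prob (negbTE lv) mul0r pr_ge0.
apply: (@le_trans _ _ (pr v (pshift 1 @^-1` (remains_low m)))).
  by apply: ler_piMl; [exact: pr_ge0|exact: survival_le1].
rewrite le_eqVlt; apply/orP; left; apply/eqP; apply: (eq_pr rw).
- exact: (measurable_pshift vs_surj _ (measurable_remains_low m)).
- exact: measurable_remains_low.
apply: filterS (ae_start rw vs_surj rho v) => w X0; split => zl.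
  by case=> [_|k km]; [rewrite /trajectory X0|exact: zl].
by move=> k km; exact: (zl k.+1).
Qed.

(** No death occurs before time [N], since no cut edge is in reach. If the walk is in [S] from then
    on, either it dies in [S], with expected number of deaths at [w] at most
    [green w * (1 - survival w)], or it survives [N + M] steps and so remains low. *)
Lemma stays_le_killed (N M : nat) (D : set V) : finite_set D -> root_ball (N + M).+1 `<=` D ->
  (forall w, root_ball N w -> low w) ->
  pr rho (stays N) <=
  \sum_(w \in D) green w * ((1 - survival w) * (w \in S)%:R) + pr rho (remains_low (N + M)).
Proof.
move=> fD nD deep.
pose pair n (g : V -> R) := \sum_(w \in D) alive n w * g w.
have pair0 g : pair 0%N g = g rho.
  rewrite /pair (fsbigD1 rho)//=; last by apply: nD; exact: (@sub_root_ball 0).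
  by rewrite eqxx mul1r fsbig1 ?addr0// => w [_ /eqP/negbTE ->]; rewrite mul0r.
have le_pair n g1 g2 : (forall w, alive n w != 0 -> g1 w <= g2 w) -> pair n g1 <= pair n g2.
  move=> g12; rewrite /pair !fsbig_finite//=; apply: ler_sum => w _.
  have [->|a0] := eqVneq (alive n w) 0; first by rewrite !mul0r.
  by rewrite ler_wpM2l ?alive_ge0// g12.
have in_ball n w : alive n w != 0 -> root_ball n w.
  by move=> a0; apply: contrapT => /alive_out a1; rewrite a1 eqxx in a0.
have pairS n g : (n <= N + M)%N -> pair n.+1 g = pair n (fun w => survival w * step g w).
  by move=> nNM; rewrite /pair alive_step//; apply: subset_trans nD; exact: sub_root_ball.
have early n : (n <= N)%N -> pr rho (stays N) = pair n (fun v => pr v (stays (N - n))).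
  elim: n => [_|n IHn nN]; first by rewrite pair0 subn0.
  rewrite IHn ?(ltnW nN)// pairS; last by rewrite (leq_trans (ltnW nN))// leq_addr.
  apply/eqP; rewrite eq_le; apply/andP.
  have eqn w : alive n w != 0 -> survival w = 1.
    move=> /in_ball wn; apply: survival_deep.
      by apply: deep; apply: sub_root_ball wn; exact: ltnW.
    by move=> w' ww'; apply: deep; apply: sub_root_ball (root_ball_nbrs wn ww').
  by split; apply: le_pair => w /eqn ->; rewrite mul1r -stays_step subnSK.
(* From time [N] on, each step splits the mass into what dies, necessarily in [S], and what
   survives. *)
have late k : (k <= M)%N -> pr rho (stays N) <=
    \sum_(n < k) pair (N + n)%N (fun w => (1 - survival w) * (w \in S)%:R) +
    pair (N + k)%N (fun v => pr v (stays 0)).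
  elim: k => [_|k IHk kM].
    by rewrite big_ord0 add0r addn0 (early N)// subnn.
  apply: le_trans (IHk (ltnW kM)) _; rewrite big_ord_recr -addrA lerD2l addnS.
  rewrite pairS ?leq_add2l ?(ltnW kM)//.
  rewrite /pair -fsbig_split//=; rewrite !fsbig_finite//=; apply: ler_sum => w _.
  rewrite -mulrDr ler_wpM2l ?alive_ge0//.
  rewrite -[leLHS]mul1r -[1 in leLHS](subrK (survival w)) mulrDl lerD//.
    by rewrite ler_wpM2l ?subr_ge0 ?survival_le1 ?pr_stays0_le1S.
  rewrite ler_wpM2l ?survival_ge0// -stays_step.
  apply: (le_pr rw); [exact: measurable_stays|exact: measurable_stays|].
  by move=> z zS n _; exact: zS.
apply: le_trans (late M (leqnn _)) _; apply: lerD.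
  rewrite /pair; under eq_bigr do rewrite fsbig_finite//=.
  rewrite exchange_big fsbig_finite//=; apply: ler_sum => w _.
  rewrite -mulr_suml ler_wpM2r//; first by rewrite mulr_ge0 ?subr_ge0 ?survival_le1.
  apply: le_trans (sum_alive_le_green (N + M) w).
  rewrite [leRHS]big_split_ord lerDr; apply: sumr_ge0 => n _; exact: alive_ge0.
have low_bound n : (n <= N + M)%N ->
    pair n (fun v => pr v (remains_low (N + M - n))) <= pr rho (remains_low (N + M)).
  elim: n => [_|n IHn nN]; first by rewrite pair0 subn0.
  apply: le_trans (IHn (ltnW nN)); rewrite pairS ?(ltnW nN)//.
  apply: le_pair => w _; apply: le_trans (remains_low_step _ _) _.
  by rewrite subnSK.
apply: le_trans (low_bound _ (leqnn _)); apply: le_pair => w _; rewrite subnn.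
apply: (le_pr rw); [exact: measurable_stays|exact: measurable_remains_low|].
by move=> z _ k.
Qed.

End KilledWalk.

(** * The death law in terms of the lengths of the edges cut at height [t] *)

Section CutLength.
Variables (R : realType) (V E : choiceType) (src tgt : E -> V) (c : E -> R).
Hypothesis net : is_network src tgt c.
Hypothesis inc_n0 : forall u, incident src tgt u !=set0.
Variables (d : measure_display) (Om : measurableType d)
  (P : V -> probability Om R) (X : nat -> Om -> V).
Hypothesis rw : is_random_walk src tgt c P X.
Variable vs : nat -> V.
Hypothesis vs_surj : forall v, exists n, vs n = v.
Variables (rho : V) (a : E -> R).

Local Notation cp := (cond_pair src tgt c).
Local Notation cv := (cond_vert src tgt c).
Local Notation inc := (incident src tgt).
Local Notation nb := (nbrs src tgt).
Local Notation oth := (other_end src tgt).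
Local Notation y := (yv P X rho).
Local Notation eta := (eta_cyl src tgt c P X rho).
Local Notation ylo := (ylo src tgt P X rho).
Local Notation yhi := (yhi src tgt P X rho).
Local Notation len := (len src tgt c P X rho).
Local Notation Iedge := (Iedge src tgt c P X rho a).
Local Notation rect := (rect src tgt c P X rho a).
Hypothesis eta_gt0 : 0 < eta.
Variable t : R.
Hypothesis t_gt0 : 0 < t.

Local Notation low := (is_low P X rho t).
Local Notation green := (green_bound src tgt c P X rho t).
Local Notation survival := (survival_prob src tgt c P X rho t).

(** Summed over [e] and divided by [eta], the law of the position of the killed walk
    at its death: a uniform angle at height [t], moved along its edge to an end. *)
Definition cut_weight (w : V) (e : E) : R :=
  if low w (+) low (oth w e) then c e * `|y (oth w e) - t| else 0.

Lemma green_killed w : green w * (1 - survival w) = (\sum_(e \in inc w) cut_weight w e) / eta.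
Proof.
have fn := finite_nbrs net w.
have weightE : \sum_(e \in inc w) cut_weight w e =
    \sum_(w' \in nb w) cp w w' * (if low w (+) low w' then `|y w' - t| else 0).
  rewrite sum_nbrsE//; apply: eq_fsbigr => e _; rewrite /cut_weight.
  by case: ifP; rewrite ?mulr0.
rewrite weightE; have [lw|lw] := boolP (low w).
  rewrite (green_low net inc_n0 rw vs_surj)// mulrAC; congr (_ / _).
  have ct0 : 0 < cut_cond src tgt c P X rho t w.
    by rewrite (lt_le_trans (cond_vert_gt0 net inc_n0 w))// (le_cut_cond net).
  rewrite /survival_prob lw mulrBr mulr1 -mulrA [_ * (_ / _)]mulrC mulfVK ?gt_eqF//.
  rewrite (cut_cond_flow net)// (cond_vertE net) !fsbig_finite//= mulr_sumr -sumrB.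
  apply: eq_bigr => w' _; rewrite [_ * cp _ _]mulrC -mulrBr; congr (_ * _).
  case: ifPn => /= lw'; first by rewrite subrr.
  rewrite ger0_norm; first by ring.
  by rewrite subr_ge0 leNgt.
rewrite /survival_prob (negbTE lw) subr0 mulr1 /green_bound.
have /eqP/negbTE -> : w <> rho by move=> wr; move: lw; rewrite wr (low_root rw vs_surj _ t_gt0).
rewrite add0r; congr (_ / _); apply: eq_fsbigr => w' _; congr (_ * _).
case: ifPn => //= lw'; rewrite distrC ger0_norm// subr_ge0; exact: ltW.
Qed.

Definition cut_len (e : E) : R := if ylo e < t <= yhi e then len e else 0.

(** The two ends of a cut edge carry [c e] times the distances from [t] to the opposite heights,
    which add up to [len e]. Only ends in [S] count, hence an inequality. Loops are never cut. *)
Lemma sum_cut_weight (D : set V) (S : set V) : finite_set D ->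
  \sum_(w \in D) green w * ((1 - survival w) * (w \in S)%:R) <=
  (\sum_(e \in \bigcup_(w in D `&` S) inc w) cut_len e) / eta.
Proof.
move=> fD; set Es := \bigcup_(w in D `&` S) inc w.
have fEs : finite_set Es.
  apply: bigcup_finite; first exact: finite_setIl.
  by move=> w _; exact: (finite_incident net).
have w_ge0 w e : 0 <= cut_weight w e.
  by rewrite /cut_weight; case: ifP => // _; rewrite mulr_ge0// ltW//; case: net.
pose f w e := if (w \in S) && (e \in inc w) then cut_weight w e else 0.
have lhsE w : D w -> green w * ((1 - survival w) * (w \in S)%:R) = (\sum_(e \in Es) f w e) / eta.
  move=> Dw; rewrite mulrA green_killed; case: (boolP (w \in S)) => wS.
    rewrite mulr1; congr (_ / _); rewrite (eq_fsbigr (f w)).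
      rewrite (@fsbig_widen _ _ _ _ (inc w) Es)//.
      - by move=> e we; exists w => //; split => //; exact: set_mem.
      - by move=> e [_ we] /=; rewrite /f; case: ifP => // /andP[_ /set_mem].
    by move=> e ewe; rewrite /f wS ewe.
  by rewrite mulr0 fsbig1 ?mul0r// => e _; rewrite /f (negbTE wS).
rewrite (eq_fsbigr (fun w => (\sum_(e \in Es) f w e) / eta)); last first.
  by move=> w /set_mem; exact: lhsE.
rewrite !fsbig_finite//= -mulr_suml.
rewrite ler_wpM2r ?invr_ge0 ?(ltW eta_gt0)//.
under [leLHS]eq_bigr => w _ do rewrite fsbig_finite//=.
rewrite exchange_big; apply: ler_sum => e _ /=.
have othS : oth (src e) e = tgt e by rewrite /other_end eqxx.
have othT : oth (tgt e) e = src e by rewrite /other_end; case: eqP => // ->.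
have [st|st] := eqVneq (src e) (tgt e).
  rewrite big1 => [|w _].
    by rewrite /cut_len /Defs.ylo /Defs.yhi st minxx maxxx; case: ltgtP.
  rewrite /f; case: ifP => // /andP[_ /set_mem we].
  have -> : cut_weight w e = 0; last by [].
  by rewrite /cut_weight; case: we => <-; rewrite ?othS ?othT st addbb.
apply: (@le_trans _ _ (\sum_(w <- finmap.enum_fset (fset_set D))
    ((w == src e)%:R * cut_weight (src e) e + (w == tgt e)%:R * cut_weight (tgt e) e))).
  apply: ler_sum => w _; rewrite /f; case: ifPn => [/andP[_ /set_mem[<-|<-]]|_].
  - by rewrite eqxx mul1r lerDl mulr_ge0.
  - by rewrite eqxx mul1r lerDr mulr_ge0.
  by rewrite addr_ge0// mulr_ge0.
have count1 v : \sum_(w <- finmap.enum_fset (fset_set D)) (w == v)%:R <= 1 :> R.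
  rewrite -natr_sum -[X in _ <= X]/(1%:R) ler_nat.
  rewrite -big_mkcond sum1_count count_uniq_mem ?fset_uniq//; exact: leq_b1.
rewrite big_split -!mulr_suml /=.
apply: (@le_trans _ _ (cut_weight (src e) e + cut_weight (tgt e) e)).
  by rewrite lerD// ler_piMl.
rewrite /cut_weight /cut_len othS othT /is_low /Defs.ylo /Defs.yhi /Defs.len /Defs.ylo /Defs.yhi.
have := net; case=> /(_ e) ce _ _.
case: (ltP (y (src e)) t) => h1; case: (ltP (y (tgt e)) t) => h2 /=.
- by rewrite addr0 le_max (leNgt t (y (src e))) (leNgt t (y (tgt e))) h1 h2 andbF.
- rewrite (min_l (le_trans (ltW h1) h2)) (max_r (le_trans (ltW h1) h2)) h1 h2 /=.
  by rewrite ger0_norm ?subr_ge0// ler0_norm ?subr_le0 ?(ltW h1)// -mulrDr; lra.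
- rewrite (min_r (le_trans (ltW h2) h1)) (max_l (le_trans (ltW h2) h1)) h1 h2 /=.
  by rewrite ler0_norm ?subr_le0 ?(ltW h2)// ger0_norm ?subr_ge0// -mulrDr; lra.
- by rewrite addr0 gt_min (ltNge (y (src e)) t) (ltNge (y (tgt e)) t) h1 h2.
Qed.

End CutLength.

(** * Small arcs are rarely the final location of the walk *)

Section NoAtoms.
Variables (R : realType) (V E : choiceType) (src tgt : E -> V) (c : E -> R).
Hypothesis net : is_network src tgt c.
Hypothesis inc_n0 : forall u, incident src tgt u !=set0.
Variables (d : measure_display) (Om : measurableType d)
  (P : V -> probability Om R) (X : nat -> Om -> V).
Hypothesis rw : is_random_walk src tgt c P X.
Variable vs : nat -> V.
Hypothesis vs_surj : forall v, exists n, vs n = v.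
Variables (rho : V) (a : E -> R).

Local Notation y := (yv P X rho).
Local Notation eta := (eta_cyl src tgt c P X rho).
Local Notation ylo := (ylo src tgt P X rho).
Local Notation yhi := (yhi src tgt P X rho).
Local Notation len := (len src tgt c P X rho).
Local Notation Iedge := (Iedge src tgt c P X rho a).
Local Notation rect := (rect src tgt c P X rho a).
Local Notation Ivert := (Ivert src tgt c P X rho a).
Local Notation T := (path_space rho).
Local Notation pr := (path_prob P X).
Local Notation stays := (@stays V rho).
Local Notation remains_low := (@remains_low R V d Om P X rho).
Hypothesis rect_disj : forall e1 e2, e1 <> e2 ->
  interior (rect e1) `&` interior (rect e2) = set0.
Hypothesis Ivert_arc : forall v, is_arc src tgt c P X rho (Ivert v).
Hypothesis Ivert_in : forall v, v <> rho ->
  Ivert v = \bigcup_(e in in_edges src tgt P X rho v) Iedge e.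
Hypothesis eta_gt0 : 0 < eta.
Hypothesis y_lt1 : forall v, y v < 1.
Hypothesis heights : {ae P rho, forall w, y (X n w) @[n --> \oo] --> (1 : R)}.
Hypothesis lengths : {ae P rho, forall w,
  Ilength src tgt c P X rho a (X n w) @[n --> \oo] --> 0%E}.
Variable theta : V -> R.
Hypothesis theta_in : forall v, Ivert v (theta v).

Definition near_angle (x0 delta : R) : set R :=
  [set x | exists k : int, `|x + k%:~R * eta - x0| < delta].

Definition located (x0 delta : R) : set V := [set v | Ivert v `<=` near_angle x0 delta].

(** Rectangles that all occupy heights just below [t] have disjoint open arcs; lifted into one
    interval of length [2 * delta], these are compared by Lebesgue measure. *)
Lemma sum_len_le (Es : set E) (x0 delta t : R) : finite_set Es -> 0 < delta ->
  2 * delta <= eta ->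
  (forall e, Es e -> ylo e < t <= yhi e /\ Iedge e `<=` near_angle x0 delta) ->
  \sum_(e \in Es) len e <= 2 * delta.
Proof.
move=> fEs d0 deta EsP.
have lift e : Es e -> exists k : int, forall s, 0 <= s <= len e ->
    `|a e + s + k%:~R * eta - x0| < delta.
  move=> /EsP[/andP[lt th] eJ].
  have l0 : 0 <= len e by rewrite ltW// len_gt0 ?(lt_le_trans lt)//; case: net.
  have inI s : 0 <= s <= len e -> Iedge e (a e + s).
    by move=> /andP[s0 sl]; exists 0; rewrite mul0r addr0 lerDl s0 lerD2l.
  have [|k hk] := eJ _ (inI 0 _); first by rewrite lexx.
  exists k => s /andP[s0 sl]; rewrite ltr_norml; move: hk; rewrite addr0 ltr_norml => /andP[k1 k2].
  apply/andP; split; first by lra.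
  rewrite ltNge; apply/negP => sd.
  (* The point where the arc would leave its copy of the interval. The copies are open and, by
     [2 * delta <= eta], disjoint, so this end point lies in none of them. *)
  pose s' := x0 + delta - k%:~R * eta - a e.
  have [|j] := eJ _ (inI s' _); first by rewrite /s'; apply/andP; split; lra.
  rewrite (_ : a e + s' + j%:~R * eta - x0 = delta + (j - k)%:~R * eta); last by rewrite /s' intrB; ring.
  rewrite ltr_norml => /andP[j1 j2].
  have jk : (j - k < 0)%R.
    by rewrite -(ltr_int R) -(pmulr_llt0 _ eta_gt0); lra.
  have : (j - k)%:~R <= (- 1 : R).
    by rewrite -[- 1]/(- (1%:~R)) -intrN ler_int -ltzD1 addNr.
  move=> /(ler_wpM2r (ltW eta_gt0)); lra.
pose k e : int := if pselect (Es e) is left h then projT1 (cid (lift e h)) else 0.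
have kP e : Es e -> forall s, 0 <= s <= len e -> `|a e + s + (k e)%:~R * eta - x0| < delta.
  by move=> Ee; rewrite /k; case: pselect => // h; case: cid.
have len0 e : Es e -> 0 < len e.
  by move=> /EsP[/andP[lt th] _]; rewrite len_gt0 ?(lt_le_trans lt)//; case: net.
pose F e : set R := `]a e + (k e)%:~R * eta, a e + (k e)%:~R * eta + len e[%classic.
have F_open e x : F e x -> open_arc src tgt c P X rho a e x.
  by rewrite /F /= in_itv /= => /andP[x1 x2]; exists (- k e); rewrite mulrNz; lra.
have tF : trivIset Es F.
  move=> e1 e2 E1 E2 [x [/F_open x1 /F_open x2]].
  have [/andP[l1 h1] _] := EsP _ E1; have [/andP[l2 h2] _] := EsP _ E2.
  have [s /andP[s1 s2]] : exists s, Num.max (ylo e1) (ylo e2) < s < t.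
    exists ((Num.max (ylo e1) (ylo e2) + t) / 2); apply/andP; split;
      [apply: (midf_lt _).1|apply: (midf_lt _).2]; by rewrite gt_max l1.
  move: s1; rewrite gt_max => /andP[s1 s1'].
  by apply: (rect_overlap (t := s) rect_disj x1 x2); rewrite ?s1 ?s1' (lt_le_trans s2).
have mF e : Es e -> measurable (F e) by move=> _; exact: measurable_itv.
pose J : set R := `]x0 - delta, x0 + delta[%classic.
have FJ : \bigcup_(e in Es) F e `<=` J.
  move=> x [e Ee]; rewrite /J /F /= !in_itv /= => /andP[x1 x2].
  have := kP e Ee (x - a e - (k e)%:~R * eta); rewrite (_ : a e + _ + _ = x); last by ring.
  rewrite ltr_norml => h; have [|h1 h2] := andP (h _); first by apply/andP; split; lra.
  by apply/andP; split; lra.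
have : (lebesgue_measure (\bigcup_(e in Es) F e) <= lebesgue_measure J)%E.
  exact: le_outer_measure.
rewrite measure_fin_bigcup// lebesgue_measure_itv /= lte_fin.
rewrite (_ : x0 - delta < x0 + delta); last by lra.
rewrite (eq_fsbigr (fun e => (len e)%:E)).
  rewrite fsumEFin// -EFinD lee_fin => /le_trans; apply; lra.
move=> e /set_mem Ee; rewrite /= lebesgue_measure_itv /= lte_fin ltrDl len0//.
by rewrite -EFinD addrAC subrr add0r.
Qed.

(** The bound is uniform in [N] because the cut height may depend on [N]: it is chosen above the
    ball of radius [N]. The remaining term is made small by [M], as heights tend to 1. *)
Lemma pr_stays_located (x0 delta : R) (N : nat) : 0 < delta -> 2 * delta <= eta ->
  pr rho (stays (located x0 delta) N) <= 2 * delta / eta.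
Proof.
move=> d0 deta.
have [t /andP[t0 t1] deep] : exists2 t, 0 < t < 1 & forall w, root_ball src tgt rho N w -> y w < t.
  have fB := finite_root_ball net rho N.
  pose m := \big[Num.max/0]_(w <- finmap.enum_fset (fset_set (root_ball src tgt rho N))) y w.
  have m1 : m < 1 by rewrite /m big_seq; elim/big_ind: _ => [|u v u1 v1|w _]; rewrite ?ltr01 ?gt_max ?u1.
  have m0 : 0 <= m by rewrite /m; elim/big_ind: _ => [|u v u0 v0|w _]; rewrite ?le_max ?u0 ?height_ge0.
  exists ((m + 1) / 2); first by apply/andP; split; lra.
  move=> w Bw; have : y w <= m.
    rewrite /m; apply: (@le_bigmax_seq _ _ _ _ _ w) => //.
    by rewrite in_fset_set// mem_set.
  lra.
apply/ler_addgt0Pr => eps e0.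
have [M hM] : exists M, pr rho (remains_low t (N + M)) < eps.
  pose B m : set T := ~` remains_low t m.
  have mB m : measurable (B m) by apply: measurableC; exact: (measurable_remains_low P X vs_surj).
  have ndB : nondecreasing_seq B.
    move=> m n mn; apply/subsetPset => z; apply: contra_not => zn k km.
    by apply: zn; exact: leq_trans mn.
  have hc := nondecreasing_cvg_pr rw (v := rho) mB ndB.
  have B1 : pr rho (\bigcup_m B m) = 1.
    rewrite -(prT P X rho rho); apply: (eq_pr rw) => //; first exact: bigcupT_measurable.
    apply: filterS heights => w yw; split => // _.
    have /cvgr_gt/(_ _ t1)[n _ /(_ n (leqnn n)) /= tn] := yw.
    by exists n.+1 => // /(_ n (leqnn _)); rewrite /is_low /trajectory ltNge (ltW tn).
  rewrite B1 in hc; have /cvgr_gt/(_ (1 - eps))[|n _ hn] := hc; first by lra.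
  exists n; have := hn (N + n)%N (leq_addl _ _).
  by rewrite /= /B (prC rw); [lra|exact: (measurable_remains_low P X vs_surj)].
have fD := finite_root_ball net rho (N + M).+1.
apply: le_trans (stays_le_killed net inc_n0 rw vs_surj eta_gt0 _ fD (@subset_refl _ _) deep) _.
apply: lerD; last exact: ltW.
apply: le_trans (sum_cut_weight net inc_n0 rw vs_surj eta_gt0 t0 _ fD) _.
rewrite ler_wpM2r ?invr_ge0 ?(ltW eta_gt0)//.
set Es := \bigcup_(w in _) _.
have fEs : finite_set Es.
  apply: bigcup_finite; first exact: finite_setIl.
  by move=> w _; exact: (finite_incident net).
rewrite (eq_fsbigr (fun e => if e \in [set e | ylo e < t <= yhi e] then len e else 0)); last first.
  by move=> e _; rewrite /cut_len; case: ifPn => h; [rewrite mem_set|rewrite memNset//; exact/negP].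
rewrite -fsbig_mkcondr; apply: (sum_len_le (x0 := x0) (t := t)) => //; first exact: finite_setIl.
move=> e [[w [_ Sw] we] cut]; split => //.
apply: subset_trans Sw; apply: Iedge_incident => //; [exact: height_ge0|exact: (height_root rw vs_surj)].
Qed.

Lemma no_atoms (x0 : R) : {ae P rho, forall w,
  ~ circ_conv src tgt c P X rho (fun n => theta (X n w)) x0}.
Proof.
(* Chosen so that the bound [2 * delta j / eta] is [1 / (j + 1)]. *)
pose delta (j : nat) : R := eta / (2 * j.+1%:R).
have d0 j : 0 < delta j by rewrite divr_gt0// mulr_gt0.
pose A (j : nat) : set T := \bigcup_N stays (located x0 (delta j)) N.
have mS j N : measurable (stays (located x0 (delta j)) N) by exact: (measurable_stays vs_surj).
have mA j : measurable (A j) by exact: bigcupT_measurable.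
have prA j : pr rho (A j) <= j.+1%:R^-1.
  have ndS : nondecreasing_seq (stays (located x0 (delta j))).
    by move=> m n mn; apply/subsetPset => z zm k nk; apply: zm; exact: leq_trans nk.
  have hc := nondecreasing_cvg_pr rw (v := rho) (mS j) ndS.
  rewrite -(cvg_lim _ hc)//; apply: limr_le; first by apply/cvg_ex; eexists; exact: hc.
  near=> N; apply: le_trans (pr_stays_located _ _ (d0 j) _) _.
    rewrite /delta (_ : 2 * _ = eta / j.+1%:R).
      by rewrite ler_pdivrMr// ler_peMr ?(ltW eta_gt0)// ler1n.
    by field; rewrite ?pnatr_eq0.
  rewrite /delta (_ : 2 * _ / _ = j.+1%:R^-1)//.
  by field; rewrite nat1r pnatr_eq0 /= lt0r_neq0.
have : {ae P rho, forall w, exists j, ~ A j (trajectory X rho w)}.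
  by apply: (ae_exists_not rw mA prA); exact: cvg_harmonic.
apply: filterS2 lengths => w wl [j nA] [k thk]; apply: nA.
have xj := d0 j.
have /fine_cvgP[fin /cvgr_lt] := wl; have e4 : 0 < delta j / 4 by rewrite divr_gt0.
move=> /(_ _ e4)[n1 _ h1]; have [n2 _ h2] := fin.
have e2 : 0 < delta j / 2 by rewrite divr_gt0.
have /cvgr_dist_lt/(_ _ e2)[n3 _ h3] := thk.
(* Convergence of the points [theta] and vanishing arc widths bring entire arcs near [x0], as
   [located] demands. *)
exists (maxn n1 (maxn n2 n3)) => // n; rewrite !geq_max => /and3P[n1n n2n n3n] x Ix.
have wd : arc_width Ivert_arc (X n w) < delta j / 2.
  have := Ilength_ge Ivert_arc eta_gt0 (X n w); have := h1 _ n1n; have := h2 _ n2n => /= fn.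
  by rewrite -(fineK fn) lee_fin /= => u v; lra.
have [q hq] := Ivert_near Ivert_arc (Ivert_shift (k n) (theta_in (X n w))) Ix.
exists q; have := h3 _ n3n; rewrite /= distrC => h4.
rewrite (_ : _ - x0 = (x + q%:~R * eta - (theta (X n w) + (k n)%:~R * eta)) +
  (theta (X n w) + (k n)%:~R * eta - x0)); last by ring.
rewrite (le_lt_trans (ler_normD _ _))// (splitr (delta j)) ltrD//.
exact: le_lt_trans wd.
Unshelve. all: by end_near. Qed.

End NoAtoms.

(** * The boundary function *)

Section Expectation.
Variables (R : realType) (V E : choiceType) (src tgt : E -> V) (c : E -> R).
Hypothesis net : is_network src tgt c.
Hypothesis inc_n0 : forall u, incident src tgt u !=set0.
Variables (d : measure_display) (Om : measurableType d)
  (P : V -> probability Om R) (X : nat -> Om -> V).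
Hypothesis rw : is_random_walk src tgt c P X.
Variable vs : nat -> V.
Hypothesis vs_surj : forall v, exists n, vs n = v.

Local Notation isteps := (walk_steps src tgt c).
Local Notation ball := (root_ball src tgt).

Lemma eq_isteps_ball n g1 g2 v : (forall u, ball v n u -> g1 u = g2 u) ->
  isteps n g1 v = isteps n g2 v.
Proof.
have ballS k u w : nbrs src tgt v u -> ball u k w -> ball v k.+1 w.
  move=> vu; elim: k w => [|k IHk] w; first by move=> /= ->; right; exists v.
  move=> [uw|[x ux xw]]; first by left; exact: IHk.
  by right; exists x => //; exact: IHk.
elim: n v ballS => [v _ h|n IHn v ballS h]; first exact: h.
rewrite !istepsS; apply: eq_step => u vu; apply: IHn.
  move=> k u' w uu'; elim: k w => [|k IHk] w; first by move=> /= ->; right; exists u.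
  move=> [uw|[x ux xw]]; first by left; exact: IHk.
  by right; exists x => //; exact: IHk.
by move=> w uw; apply: h; exact: ballS uw.
Qed.

Lemma ae_root_ball n v : {ae P v, forall w, ball v n (X n w)}.
Proof.
apply: filterS2 (ae_start rw vs_surj v v) (ae_nbrs net inc_n0 rw vs_surj v v) => w X0 Xn.
by elim: n => [|n IHn]; [exact: X0|right; exists (X n w)].
Qed.

Lemma pr_at n v u : path_prob P X v ([set z | z n = u] : set (path_space v)) =
  isteps n (fun w => (w == u)%:R) v.
Proof.
pose A : set (path_space v) := [set z | z 0%N = u].
have mA : measurable A by exact: (measurable_coord v vs_surj 0%N [set u]).
rewrite (_ : [set z | _] = pshift n @^-1` A); last first.
  by apply/seteqP; split => z; rewrite /A /pshift /= addn0.
rewrite (markov_pshift net inc_n0 rw vs_surj)//; congr (walk_steps _ _ _ _ _ _).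
apply/funext => w; have [->|wu] := eqVneq w u.
  rewrite -(prT P X v u); apply: (eq_pr rw) => //.
  by apply: filterS (ae_start rw vs_surj v u) => o X0.
rewrite mulr0n -(pr0 P X v w); apply: (eq_pr rw) => //.
apply: filterS (ae_start rw vs_surj v w) => o X0; split => //.
by rewrite /A /= /trajectory X0 => /eqP; rewrite (negbTE wu).
Qed.

Lemma measurable_X n (B : set V) : measurable (X n @^-1` B).
Proof.
rewrite (_ : X n @^-1` B = \bigcup_k (if vs k \in B then X n @^-1` [set vs k] else set0)).
  apply: bigcupT_measurable => k; case: ifP => _; last exact: measurable0.
  by case: rw => + _; apply.
apply/seteqP; split => [w Bw|w [k _]].
  by have [k kw] := vs_surj (X n w); exists k => //; rewrite kw mem_set.
by case: ifP => // /set_mem Bk /= ->.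
Qed.

Lemma measurable_fun_X n (g : V -> R) : measurable_fun setT (fun w => g (X n w)).
Proof. by move=> _ Y mY; rewrite setTI; exact: (measurable_X n (g @^-1` Y)). Qed.

(** After [n] steps the walk is almost surely in a finite ball, so the integral is a finite sum of
    point probabilities. *)
Lemma expectation_X n v g :
  (\int[P v]_w (g (X n w))%:E = (isteps n g v)%:E)%E.
Proof.
have fB := finite_root_ball net v n.
pose D := finmap.enum_fset (fset_set (ball v n)).
have uD : uniq D by exact: finmap.fset_uniq.
have inD u : (u \in D) = (u \in ball v n) by rewrite /D in_fset_set.
pose f u (w : Om) : \bar R := ((g u)%:E * (\1_(X n @^-1` [set u]) w)%:E)%E.
have intf u : (P v).-integrable setT (f u).
  by apply: integrableZl => //; apply: integrable_indic; rewrite ?setTI; exact: measurable_X.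
transitivity (\int[P v]_w (\sum_(u <- D) f u w))%E.
  apply: ae_eq_integral => //.
  - by apply/measurable_EFinP; exact: measurable_fun_X.
  - by apply: emeasurable_sum => u; have /integrableP[] := intf u.
  apply: filterS (ae_root_ball n v) => w Bw _.
  rewrite (bigD1_seq (X n w)) ?inD ?mem_set//=.
  rewrite /f indicE mem_set// mule1 big1 ?adde0// => u uX.
  by rewrite indicE memNset ?mule0// => /= /eqP; rewrite eq_sym (negbTE uX).
rewrite (integral_sum measurableT intf D xpredT).
have isum s : isteps n (fun w => \sum_(u <- s) g u * (w == u)%:R) v =
    \sum_(u <- s) g u * isteps n (fun w => (w == u)%:R) v.
  elim: s => [|u s IHs].
    rewrite big_nil -[RHS](isteps_cst net inc_n0 n 0 v); congr (walk_steps _ _ _ _ _ _).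
    by apply/funext => w; rewrite big_nil.
  rewrite big_cons -IHs -(istepsZ net) -(istepsD net); congr (walk_steps _ _ _ _ _ _).
  by apply/funext => w; rewrite big_cons.
rewrite (@eq_isteps_ball _ _ (fun w => \sum_(u <- D) g u * (w == u)%:R)); last first.
  move=> u Bu; rewrite (bigD1_seq u) ?inD ?mem_set//= eqxx mulr1 big1 ?addr0//.
  by move=> w; rewrite eq_sym => /negbTE ->; rewrite mulr0.
rewrite isum -sumEFin; apply: eq_bigr => u _.
rewrite integralZl//; last first.
  by apply: integrable_indic; rewrite ?setTI; exact: measurable_X.
rewrite integral_indic ?setIT//; last exact: measurable_X.
rewrite EFinM -pr_at -(prE rw)//.
exact: (measurable_coord v vs_surj n [set u]).
Qed.

End Expectation.

(** * A measurable choice of the limit angle *)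

Section CircleLimits.
Variables (R : realType) (V E : choiceType) (src tgt : E -> V) (c : E -> R).
Variables (d : measure_display) (Om : measurableType d)
  (P : V -> probability Om R) (X : nat -> Om -> V).
Variable rho : V.
Variable vs : nat -> V.
Hypothesis vs_surj : forall v, exists n, vs n = v.

Local Notation eta := (eta_cyl src tgt c P X rho).
Local Notation circ_conv := (circ_conv src tgt c P X rho).
Local Notation T := (path_space rho).
Hypothesis eta_gt0 : 0 < eta.
Variable theta : V -> R.

Lemma int_multiple_small (k : int) : `|k%:~R * eta| < eta -> k = 0.
Proof.
rewrite normrM (gtr0_norm eta_gt0) -[ltRHS]mul1r ltr_pM2r// -intr_norm.
rewrite -[1]/(1%:~R) ltr_int => k1; apply/eqP; rewrite -normr_eq0 eq_le normr_ge0 andbT.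
by rewrite -ltzD1 add0r.
Qed.

(** The difference of the two lifted sequences is an integer multiple of [eta] that converges, hence
    is eventually constant. *)
Lemma circ_conv_unique s t t' : circ_conv s t -> circ_conv s t' ->
  exists k : int, t' = t + k%:~R * eta.
Proof.
move=> [i si] [j sj].
have small eps : 0 < eps -> exists N, forall n, (N <= n)%N ->
    `|t' - t - (j n - i n)%:~R * eta| < eps.
  move=> e0; have e2 : 0 < eps / 2 by rewrite divr_gt0.
  have /cvgr_dist_lt/(_ _ e2)[n1 _ h1] := si; have /cvgr_dist_lt/(_ _ e2)[n2 _ h2] := sj.
  exists (maxn n1 n2) => n; rewrite geq_max => /andP[n1n n2n].
  have := h1 _ n1n; have := h2 _ n2n.
  by rewrite /= intrB !ltr_norml; lra.
have eta2 : 0 < eta / 2 by rewrite divr_gt0.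
have [N hN] := small _ eta2; exists (j N - i N).
apply/eqP; rewrite -subr_eq0 opprD addrA -normr_le0; apply/ler_addgt0Pr => eps e0.
rewrite add0r; have [N' hN'] := small _ e0.
set n := maxn N N'; have Nn : (N <= n)%N by exact: leq_maxl.
have h1 := hN _ (leqnn N); have h2 := hN _ Nn; have := hN' n (leq_maxr _ _).
suff -> : j N - i N = j n - i n by move/ltW.
apply/eqP; rewrite -subr_eq0; apply/eqP/int_multiple_small; rewrite (intrB _ (j N - i N)).
by move: h1 h2; rewrite !ltr_norml; lra.
Qed.

Lemma circ_conv_pshift (z : nat -> V) t : circ_conv (theta \o z) t ->
  circ_conv (theta \o pshift 1 z) t.
Proof.
move=> [k zk]; exists (fun n => k (1 + n)%N); rewrite /pshift /=.
rewrite (_ : (fun n => _) = [sequence theta (z (n + 1)%N) + (k (n + 1)%N)%:~R * eta]_n).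
  by rewrite (cvg_shiftn 1 (fun n => theta (z n) + (k n)%:~R * eta)).
by apply/funext => n; rewrite addnC.
Qed.

(** Successive lifts to [R] of the angles along a path, each chosen nearest to the
    previous one. *)
Fixpoint lift (z : nat -> V) (n : nat) : R :=
  if n is m.+1 then
    theta (z n) + (Num.floor ((lift z m - theta (z n)) / eta + 2^-1))%:~R * eta
  else theta (z 0%N).

Lemma lift_theta z n : exists k : int, lift z n = theta (z n) + k%:~R * eta.
Proof. by case: n => [|n]; [exists 0; rewrite mul0r addr0|eexists]. Qed.

Lemma lift_dist z n : `|lift z n.+1 - lift z n| <= eta / 2.
Proof.
rewrite /= ; set s := lift z n; set th := theta _; set k := Num.floor _.
have /andP[] := floor_itv ((s - th) / eta + 2^-1); rewrite -/k.
have : (s - th) / eta * eta = s - th by rewrite mulfVK// gt_eqF.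
move: (_ / _) => q qE; rewrite -(ler_pM2r eta_gt0) -(ltr_pM2r eta_gt0) intrD ler_norml; lra.
Qed.

(** Once the given lift varies by less than [eta / 8] around its limit, the nearest-lift rule cannot
    change the winding. Thus the arbitrary integers in [circ_conv] can be replaced by a lift that
    depends on finitely many coordinates. *)
Lemma lift_cvg (z : nat -> V) t : circ_conv (theta \o z) t ->
  exists k : int, lift z @ \oo --> t + k%:~R * eta.
Proof.
move=> [k zk]; have /choice[m zm] := lift_theta z.
pose u n := theta (z n) + (k n)%:~R * eta; pose D n := m n - k n.
have liftE n : lift z n = u n + (D n)%:~R * eta by rewrite zm /u /D intrB; ring.
have e8 : 0 < eta / 8 by rewrite divr_gt0.
have /cvgr_dist_lt/(_ _ e8)[N _ hN] := zk.
have DS n : (N <= n)%N -> D n.+1 = D n.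
  move=> Nn; apply/eqP; rewrite -subr_eq0; apply/eqP/int_multiple_small.
  have := lift_dist z n; have := hN _ Nn; have := hN _ (leqW Nn); rewrite !liftE /= -/(u n) -/(u n.+1).
  move: (D n.+1) (D n) => i j; rewrite intrB.
  by rewrite !ltr_norml ler_norml; lra.
have DN n : (N <= n)%N -> D n = D N.
  by move=> /subnKC <-; elim: (n - N)%N => [|i IHi]; rewrite ?addn0// addnS DS ?leq_addr.
exists (D N).
apply: cvg_trans (_ : (fun n => u n + (D N)%:~R * eta) @ \oo --> t + (D N)%:~R * eta); last first.
  by apply: cvgD; [exact: zk|exact: cvg_cst].
by apply: near_eq_cvg; exists N => // n /= /DN Dn; rewrite liftE Dn.
Qed.

Lemma circ_conv_lift (z : nat -> V) t : lift z @ \oo --> t -> circ_conv (theta \o z) t.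
Proof.
move=> zt; have /choice[m zm] := lift_theta z; exists m.
by rewrite (_ : (fun n => _) = lift z)//; apply/funext => n; rewrite zm.
Qed.

Lemma lift_depends z z' n : (forall i, (i <= n)%N -> z i = z' i) -> lift z n = lift z' n.
Proof.
elim: n => [|n IHn] zz' /=; first by rewrite zz'.
by rewrite zz'// IHn// => i ni; rewrite zz'// ltnW.
Qed.

Lemma measurable_lift n : measurable_fun setT (lift ^~ n : T -> R).
Proof.
move=> _ Y mY; rewrite setTI; apply: (@measurable_depends _ rho _ vs_surj n) => z z' zz'.
by rewrite /preimage /= (lift_depends zz').
Qed.

Definition convergent_paths : set T :=
  \bigcap_(j : nat) \bigcup_(N : nat) \bigcap_(n : nat) \bigcap_(m : nat)
    [set z | (N <= n)%N -> (N <= m)%N -> `|lift z n - lift z m| <= j.+1%:R^-1].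

Lemma measurable_convergent_paths : measurable convergent_paths.
Proof.
apply: bigcapT_measurable => j; apply: bigcupT_measurable => N.
apply: bigcapT_measurable => n; apply: bigcapT_measurable => m.
apply: (@measurable_depends _ rho _ vs_surj (maxn n m)) => z z' zz' /=.
by rewrite !(@lift_depends z z')// => i im; apply: zz'; rewrite leq_max im ?orbT.
Qed.

Lemma convergent_pathsP z : convergent_paths z <-> cvgn (lift z).
Proof.
split => [zc|/cvg_ex[l zl] j _]; last first.
  have : 0 < j.+1%:R^-1 :> R by rewrite invr_gt0.
  move: (j.+1%:R^-1) => q q0; have e0 : 0 < q / 2 by rewrite divr_gt0.
  have /cvgr_dist_lt/(_ _ e0)[N _ hN] := zl.
  exists N => // n _ m _ Nn Nm; have := hN _ Nn; have := hN _ Nm.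
  by rewrite !ltr_norml ler_norml; lra.
apply: cauchy_cvg; apply/cauchy_ballP => e e0.
have [j je] : exists j, j.+1%:R^-1 < e.
  have [j] := near_infty_natSinv_lt (PosNum e0).
  by move=> _ /(_ j (leqnn j)) /= ?; exists j.
have [N _ hN] := zc j I.
exists (lift z @` [set n | (N <= n)%N], lift z @` [set n | (N <= n)%N]).
  by split; exists N => // n /= Nn; exists n.
move=> [_ _] /= [[n Nn <-] [m Nm <-]]; rewrite -ball_normE /=.
exact: le_lt_trans (hN n I m I Nn Nm) je.
Qed.

(** The indicator makes the sequence converge on every path, with limit 0 off [convergent_paths], so
    that measurability passes to the limit. *)
Definition limit_angle (z : T) : R := limn (fun n => \1_convergent_paths z * lift z n).

Lemma cvg_limit_angle z :
  (fun n => \1_convergent_paths z * lift z n) @ \oo --> limit_angle z.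
Proof.
have [zc|zc] := pselect (convergent_paths z).
  apply: is_cvgM; first exact: is_cvg_cst.
  exact/convergent_pathsP.
rewrite /limit_angle (_ : (fun n => _) = (fun=> 0)).
  exact: is_cvg_cst.
by apply/funext => n; rewrite indicE memNset// mul0r.
Qed.

Lemma measurable_limit_angle : measurable_fun setT limit_angle.
Proof.
apply: (@measurable_fun_cvg _ _ _ _ (fun n z => \1_convergent_paths z * lift z n)).
  move=> n; apply: measurable_funM; last exact: measurable_lift.
  by apply: measurable_indic; exact: measurable_convergent_paths.
by move=> z _; exact: cvg_limit_angle.
Qed.

Lemma circ_conv_limit_angle z : convergent_paths z -> circ_conv (theta \o z) (limit_angle z).
Proof.
move=> zc; apply: circ_conv_lift; have := @cvg_limit_angle z.
rewrite (_ : (fun n => _) = lift z)//; apply/funext => n.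
by rewrite indicE mem_set// mul1r.
Qed.

Lemma circ_conv_convergent z t : circ_conv (theta \o z) t -> convergent_paths z.
Proof. by move=> /lift_cvg[k zk]; apply/convergent_pathsP/cvg_ex; eexists; exact: zk. Qed.

End CircleLimits.

(** * Recovering the limit of [h] from the limit angle *)

Section BoundaryFunction.
Variables (R : realType) (V E : choiceType) (src tgt : E -> V) (c : E -> R).
Variables (d : measure_display) (Om : measurableType d)
  (P : V -> probability Om R) (X : nat -> Om -> V) (rho : V) (a : E -> R).

Local Notation Iedge := (Iedge src tgt c P X rho a).
Local Notation rect := (rect src tgt c P X rho a).
Local Notation Ivert := (Ivert src tgt c P X rho a).
Local Notation y := (yv P X rho).
Local Notation eta := (eta_cyl src tgt c P X rho).
Local Notation circ_conv := (circ_conv src tgt c P X rho).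
Local Notation lifted_ray := (lifted_ray src tgt c P X rho a).

Hypothesis c_gt0 : forall e, 0 < c e.
Hypothesis rect_disj : forall e1 e2, e1 <> e2 ->
  interior (rect e1) `&` interior (rect e2) = set0.
Hypothesis rect_cover : \bigcup_(e in [set: E]) rect e = [set p | 0 <= p.2 < 1].
Hypothesis Ivert_arc : forall v, is_arc src tgt c P X rho (Ivert v).
Hypothesis Ivert_in : forall v, v <> rho ->
  Ivert v = \bigcup_(e in in_edges src tgt P X rho v) Iedge e.
Hypothesis eta_gt0 : 0 < eta.
Hypothesis y_ge0 : forall v, 0 <= y v.
Hypothesis y_rho : y rho = 0.
Hypothesis countable_edges : countable [set: E].
Variable theta : V -> R.
Hypothesis theta_in : forall v, Ivert v (theta v).
Variable vs : nat -> V.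
Hypothesis vs_surj : forall v, exists n, vs n = v.
Variables (h : V -> R) (M : R).
Hypothesis h_bounded : forall v, `|h v| <= M.

Local Notation arc_start := (arc_start Ivert_arc).
Local Notation arc_width := (arc_width Ivert_arc).

Definition height_level (m : nat) : R := 1 - m.+1%:R^-1.

(** Ends of the rays from [v], lifted to start in the fundamental copy of [Ivert v],
    that stay above level [m] and in the region where [h] is at most [q]. *)
Definition ray_ends (m : nat) (q : R) (v : V) : set R :=
  [set zeta | exists z al, [/\ lifted_ray z al zeta, z 0%N = v,
    arc_start v <= al 0%N <= arc_start v + arc_width v &
    forall k, h (z k) <= q /\ height_level m < y (z k)]].

Definition shadow (m : nat) (q : R) : set R :=
  [set x | exists v (k : int) zeta zeta', [/\ ray_ends m q v zeta, ray_ends m q v zeta' &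
    zeta < x + k%:~R * eta < zeta']].

(** A union of open intervals, possibly uncountable: openness gives measurability although nothing
    is known about the sets of ray ends. *)
Lemma open_shadow m q : open (shadow m q).
Proof.
rewrite (_ : shadow m q = \bigcup_(i in [set i : V * int * (R * R) |
    ray_ends m q i.1.1 i.2.1 /\ ray_ends m q i.1.1 i.2.2])
    [set x | i.2.1 - i.1.2%:~R * eta < x < i.2.2 - i.1.2%:~R * eta]).
  apply: bigcup_open => -[[v k] [u u']] _ /=.
  by rewrite (_ : [set x | _] = `]u - k%:~R * eta, u' - k%:~R * eta[%classic)//; exact: itv_open.
apply/seteqP; split => x.
  move=> [v [k [u [u' [vu vu' /andP[ux xu']]]]]]; exists (v, k, (u, u')) => //=.
  by rewrite ltrBlDr ux ltrBrDr.
move=> [[[v k] [u u']] /= [vu vu'] /andP[ux xu']]; exists v, k, u, u'; split => //.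
by rewrite -ltrBlDr ux -ltrBrDr.
Qed.

(** Up to null sets, the boundary angles at which the limit of [h] is at most [q]. *)
Definition sublevel (q : R) : set R := \bigcap_m shadow m q.

Lemma measurable_sublevel q : measurable (sublevel q).
Proof. by apply: bigcapT_measurable => m; exact: (open_measurable (@open_shadow m q)). Qed.

Lemma sublevel_period q x : sublevel q (x + eta) <-> sublevel q x.
Proof.
split=> xq m _; have [v [k [u [u' [vu vu' ux]]]]] := xq m I.
  exists v, (k + 1), u, u'; split => //; rewrite intrD mulrDl mul1r.
  by rewrite (_ : x + _ = x + eta + k%:~R * eta)//; ring.
exists v, (k - 1), u, u'; split => //; rewrite intrB mulrBl mul1r.
by rewrite (_ : x + eta + _ = x + k%:~R * eta)//; ring.
Qed.

Definition rat_seq (k : nat) : R := ratr (odflt 0 (unpickle k : option rat)).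

Lemma rat_seq_between (u v : R) : u < v -> exists k, u < rat_seq k < v.
Proof.
move=> /rat_in_itvoo[q]; rewrite in_itv /= => uqv.
by exists (pickle q); rewrite /rat_seq pickleK.
Qed.

(** On [sublevel (rat_seq k)] this is the rational clamped to [[-(M + 1), M + 1]], elsewhere
    [M + 1]. The infimum over [k] is then bounded, and the indicator makes it measurable. *)
Definition boundary_term (k : nat) (x : R) : R :=
  M + 1 - \1_(sublevel (rat_seq k)) x * (M + 1 - Num.max (- (M + 1)) (Num.min (M + 1) (rat_seq k))).

Definition boundary_value (x : R) : R := infs (boundary_term ^~ x) 0.

Let M_ge0 : 0 <= M.
Proof. exact: le_trans (normr_ge0 _) (h_bounded rho). Qed.

Lemma boundary_term_in k x : sublevel (rat_seq k) x ->
  boundary_term k x = Num.max (- (M + 1)) (Num.min (M + 1) (rat_seq k)).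
Proof. by move=> qx; rewrite /boundary_term indicE mem_set// mul1r; ring. Qed.

Lemma boundary_term_out k x : ~ sublevel (rat_seq k) x -> boundary_term k x = M + 1.
Proof. by move=> qx; rewrite /boundary_term indicE memNset// mul0r subr0. Qed.

Lemma boundary_term_bound k x : `|boundary_term k x| <= M + 1.
Proof.
have M1 : - (M + 1) <= M + 1 by move: M_ge0; lra.
have [qx|qx] := pselect (sublevel (rat_seq k) x).
  rewrite boundary_term_in// ler_norml le_max lexx /= ge_max M1 ge_min lexx//.
by rewrite boundary_term_out// ger0_norm//; move: M_ge0; lra.
Qed.

Lemma has_lbound_boundary x : has_lbound (range (boundary_term ^~ x)).
Proof.
exists (- (M + 1)) => _ [k _ <-].
by have := boundary_term_bound k x; rewrite ler_norml => /andP[].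
Qed.

Lemma sdrop0 (u : nat -> R) : sdrop u 0 = range u.
Proof. by rewrite /sdrop; congr (_ @` _); apply/seteqP; split. Qed.

Lemma boundary_value_le k x : boundary_value x <= boundary_term k x.
Proof.
rewrite /boundary_value /infs /= sdrop0; apply: ge_inf; first exact: has_lbound_boundary.
by exists k.
Qed.

Lemma boundary_value_ge b x : (forall k, b <= boundary_term k x) -> b <= boundary_value x.
Proof.
move=> bx; rewrite /boundary_value /infs /= sdrop0; apply: lb_le_inf.
  by exists (boundary_term 0 x), 0%N.
by move=> _ [k _ <-].
Qed.

Lemma boundary_value_bound x : `|boundary_value x| <= M + 1.
Proof.
rewrite ler_norml; apply/andP; split.
  apply: boundary_value_ge => k.
  by have := boundary_term_bound k x; rewrite ler_norml => /andP[].
apply: le_trans (boundary_value_le 0 x) _.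
by have := boundary_term_bound 0 x; rewrite ler_norml => /andP[].
Qed.

Lemma measurable_boundary_value : measurable_fun setT boundary_value.
Proof.
apply: measurable_fun_infs => [x _|k]; first exact: has_lbound_boundary.
apply: measurable_funB; first exact: measurable_cst.
apply: measurable_funM; last exact: measurable_cst.
by apply: measurable_indic; exact: measurable_sublevel.
Qed.

Lemma boundary_value_period x : boundary_value (x + eta) = boundary_value x.
Proof.
rewrite /boundary_value; congr (infs _ 0); apply/funext => k.
have [qx|qx] := pselect (sublevel (rat_seq k) x).
  by rewrite !boundary_term_in//; exact/sublevel_period.
by rewrite !boundary_term_out// => /sublevel_period.
Qed.

Lemma boundary_value_int_period x (k : int) : boundary_value (x + k%:~R * eta) = boundary_value x.
Proof.
have nat_period x' (n : nat) : boundary_value (x' + n%:R * eta) = boundary_value x'.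
  elim: n => [|n IHn]; first by rewrite mul0r addr0.
  by rewrite -natr1 mulrDl mul1r addrA boundary_value_period.
case: k => n; first exact: nat_period.
by rewrite NegzE mulrNz mulNr -pmulrn -[LHS](nat_period _ n.+1) subrK.
Qed.

Let ylt1 v : y v < 1.
Proof. exact: y_lt1 rect_cover Ivert_arc v. Qed.

Lemma boundary_value_lim (z : nat -> V) (x H : R) :
  z 0%N = rho -> (forall k, nbrs src tgt (z k) (z k.+1)) -> circ_conv (theta \o z) x ->
  Ilength src tgt c P X rho a (z n) @[n --> \oo] --> 0%E ->
  y (z n) @[n --> \oo] --> (1 : R) -> h (z n) @[n --> \oo] --> H ->
  (forall m k n, ~ circ_conv (theta \o z) (sup (ray_ends m (rat_seq k) (vs n))) /\
                 ~ circ_conv (theta \o z) (inf (ray_ends m (rat_seq k) (vs n)))) ->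
  boundary_value x = H.
Proof.
move=> z0 znb zx zlen zy zh noext.
have HM : `|H| <= M.
  have /cvg_norm zh' := zh.
  rewrite -(cvg_lim (@Rhausdorff R) zh'); apply: limr_le; first by apply/cvg_ex; exists `|H|.
  by near=> n; exact: h_bounded.
have level0 m : 0 <= height_level m by rewrite /height_level subr_ge0 invf_le1// ler1n.
have level1 m : height_level m < 1 by rewrite /height_level ltrBlDr ltrDl invr_gt0.
(* A late tail of the path is a ray from [z n] with end [x], up to a period. As this end is neither
   the largest nor the smallest from [z n], two others enclose it. *)
have inB k : H < rat_seq k -> sublevel (rat_seq k) x.
  move=> Hk m _.
  have [al [n0 rays]] := path_tail_ray c_gt0 Ivert_arc Ivert_in eta_gt0 y_ge0 y_rho theta_in znb zx zlen zy.
  have /cvgr_lt/(_ _ Hk)[n1 _ h1] := zh.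
  have /cvgr_gt/(_ _ (level1 m))[n2 _ h2] := zy.
  set n := maxn n0 (maxn n1 n2).
  have n1n : (n1 <= n)%N by rewrite !leq_max leqnn !orbT.
  have n2n : (n2 <= n)%N by rewrite !leq_max leqnn !orbT.
  have [Ial ray] := rays n (leq_maxl _ _).
  have := Ial; rewrite (IvertE Ivert_arc) => -[j aln].
  have xend : ray_ends m (rat_seq k) (z n) (x + j%:~R * eta).
    exists (pshift n z), (fun i => al (n + i)%N + j%:~R * eta); split.
    - exact: lifted_ray_shift.
    - by rewrite /pshift addn0.
    - by rewrite addn0.
    - move=> i; split; first by apply/ltW/h1 => /=; rewrite (leq_trans n1n)// leq_addr.
      by apply: h2 => /=; rewrite (leq_trans n2n)// leq_addr.
  have [i iz] := vs_surj (z n).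
  have [nsup ninf] := noext m k i; rewrite iz in nsup ninf.
  have xj := circ_conv_shift j zx.
  apply: contrapT => nshadow.
  have [above|/existsNP[u /not_implyP[zu /negP]]] :=
      pselect (forall u, ray_ends m (rat_seq k) (z n) u -> u <= x + j%:~R * eta).
    apply: nsup; rewrite (_ : sup _ = x + j%:~R * eta)//.
    apply/eqP; rewrite eq_le; apply/andP; split; first by apply: ge_sup => //; exists (x + j%:~R * eta).
    by apply: ub_le_sup => //; exists (x + j%:~R * eta).
  rewrite -ltNge => xu.
  have [below|/existsNP[u' /not_implyP[zu' /negP]]] :=
      pselect (forall u, ray_ends m (rat_seq k) (z n) u -> x + j%:~R * eta <= u).
    apply: ninf; rewrite (_ : inf _ = x + j%:~R * eta)//.
    apply/eqP; rewrite eq_le; apply/andP; split; last by apply: lb_le_inf => //; exists (x + j%:~R * eta).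
    by apply: ge_inf => //; exists (x + j%:~R * eta).
  rewrite -ltNge => u'x; apply: nshadow.
  by exists (z n), j, u', u; split => //; rewrite u'x.
have outB k : sublevel (rat_seq k) x -> H <= rat_seq k.
  move=> xB; rewrite leNgt; apply/negP => kH.
  have /cvgr_gt/(_ _ kH)[N _ hN] := zh.
  (* Level [m] is above all heights of the path before time [N], and after [N] the values of [h]
     exceed the rational; so rays above that level with small [h] are never met. *)
  have [m zm] : exists m, forall n, (n < N)%N -> y (z n) <= height_level m.
    elim: N {hN} => [|N [m zm]]; first by exists 0%N.
    have yN : 0 < 1 - y (z N) by rewrite subr_gt0.
    have [m' _ hm'] := near_infty_natSinv_lt (PosNum yN).
    have := hm' _ (leq_maxl m' m) => /= hm; exists (maxn m' m) => n.
    rewrite ltnS leq_eqVlt => /predU1P[->|nN]; first by rewrite /height_level lerBrDr addrC -lerBrDr; exact: ltW.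
    apply: le_trans (zm _ nN) _; rewrite /height_level lerB// lef_pV2 ?posrE ?ltr0n//.
    by rewrite ler_nat ltnS leq_maxr.
  have [v [k' [u [u' [[w [al [wray w0 wal wk]] [w' [al' [w'ray w'0 w'al w'k]]] ux]]]]]] := xB m I.
  have seg : segment_in (Ivert (w 0%N)) (al 0%N) (al' 0%N).
    move=> s; rewrite w0 (IvertE Ivert_arc) => /andP[s1 s2]; exists 0; rewrite mul0r addr0.
    move: s1 s2 wal w'al; rewrite ge_min le_max => /orP[] s1 /orP[] s2 /andP[? ?] /andP[? ?]; apply/andP; split; lra.
  have meet (w1 : nat -> V) : (forall i, h (w1 i) <= rat_seq k /\ height_level m < y (w1 i)) ->
      forall j i, w1 i <> z j.
    move=> w1k j i wz; have [hw yw] := w1k i; rewrite wz in hw yw.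
    have [jN|Nj] := ltnP j N; first by move: (zm _ jN); rewrite leNgt yw.
    by have := hN _ Nj => /=; rewrite ltNge hw.
  apply: (rays_separate c_gt0 rect_disj rect_cover Ivert_arc Ivert_in y_ge0 y_rho
    countable_edges theta_in wray w'ray _ seg _ _ z0 znb zy (circ_conv_shift k' zx) _ _ ux).
  - by rewrite w0.
  - by move=> i; have [_] := wk i; exact: le_lt_trans.
  - by move=> i; have [_] := w'k i; exact: le_lt_trans.
  - exact: meet.
  - exact: meet.
move: HM; rewrite ler_norml => /andP[H1 H2].
apply/eqP; rewrite eq_le; apply/andP; split.
  apply/ler_addgt0Pr => e e0.
  have [|k /andP[Hk kH]] := @rat_seq_between H (H + e); first by rewrite ltrDl.
  apply: le_trans (boundary_value_le k x) _; rewrite boundary_term_in; last exact: inB.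
  rewrite ge_max ge_min (ltW kH) orbT andbT; move: M_ge0; lra.
apply: boundary_value_ge => k.
have [qx|qx] := pselect (sublevel (rat_seq k) x).
  rewrite boundary_term_in// le_max le_min outB// andbT; apply/orP; right; move: M_ge0; lra.
by rewrite boundary_term_out//; move: M_ge0; lra.
Unshelve. all: by end_near. Qed.

End BoundaryFunction.

Lemma measurable_cvg_set d (T : measurableType d) (R : realType) (G : nat -> T -> R) (F : T -> R) :
  (forall n, measurable_fun setT (G n)) -> measurable_fun setT F ->
  measurable [set z | G n z @[n --> \oo] --> F z].
Proof.
move=> mG mF.
rewrite (_ : [set z | _] = \bigcap_(j : nat) \bigcup_(N : nat) \bigcap_(n : nat)
    (if (N <= n)%N then [set z | `|G n z - F z| <= j.+1%:R^-1] else setT)).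
  apply: bigcapT_measurable => j; apply: bigcupT_measurable => N.
  apply: bigcapT_measurable => n; case: ifP => // _.
  have mGF : measurable_fun setT (fun z => `|G n z - F z|).
    by apply: measurableT_comp => //; exact: measurable_funB.
  rewrite (_ : [set z | _] = setT `&` (fun z => `|G n z - F z|) @^-1` `]-oo, j.+1%:R^-1]%classic).
    by apply: mGF => //; exact: measurable_itv.
  by rewrite setTI; apply/seteqP; split => z /=; rewrite in_itv.
apply/seteqP; split => [z Gz j _|z Gz].
  have e0 : 0 < j.+1%:R^-1 :> R by rewrite invr_gt0.
  have /cvgr_dist_lt/(_ _ e0)[N _ hN] := Gz; exists N => // n _.
  by case: ifP => // Nn; rewrite /= distrC; exact/ltW/hN.
apply/cvgrPdist_lt => e e0; have [j _ /(_ j (leqnn j)) /= je] := near_infty_natSinv_lt (PosNum e0).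
have [N _ hN] := Gz j I; exists N => // n /= Nn; have := hN n I; rewrite Nn /= distrC.
by move=> /le_lt_trans; apply.
Qed.

Theorem theorem1p1 (R : realType) (V E : choiceType)
  (src tgt : E -> V) (c : E -> R)
  (phi : V -> R * R) (gam : E -> R -> R * R)
  (d : measure_display) (Om : measurableType d)
  (P : V -> probability Om R) (X : nat -> Om -> V)
  (rho : V) (a : E -> R) (theta : V -> R) :
  is_network src tgt c ->
  plane_embedding src tgt phi gam ->
  is_random_walk src tgt c P X ->
  rect_tiling src tgt c phi gam P X rho a ->
  (forall v, Ivert src tgt c P X rho a v (theta v)) ->
  {ae P rho, forall w,
     (exists t, circ_conv src tgt c P X rho (fun n => theta (X n w)) t) /\
     (fun n => Ilength src tgt c P X rho a (X n w)) @ \oo --> 0%E} ->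
  forall h : V -> R, is_harmonic src tgt c h -> (exists M, forall v, `|h v| <= M) ->
  exists f : R -> R,
    [/\ measurable_fun setT f,
        (exists M, forall x, `|f x| <= M),
        (forall x, f (x + eta_cyl src tgt c P X rho) = f x) &
        exists L : Om -> R, measurable_fun setT L /\
          forall v,
            {ae P v, forall w,
               circ_conv src tgt c P X rho (fun n => theta (X n w)) (L w)} /\
            (h v)%:E = (\int[P v]_w (f (L w))%:E)%E].
Proof.
move=> net _ rw [_ [rect_disj rect_cover] arcs _ _] theta_in conv h hh [M hM].
have Ivert_arc v := (arcs v).1; have Ivert_in v := (arcs v).2.
have [vs vs_surj] := vertices_enumerable net rho.
have c_gt0 := conductance_gt0 net.
(* A single vertex without edges is excluded: [theta u] lies in the arc of some edge at [u]. *)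
have inc_n0 u : incident src tgt u !=set0.
  have [e ue _] := theta_in u.
  by exists e; have /out_edgesE[] := ue.
have countable_edges : countable [set: E].
  apply: sub_countable (bigcup_countable (countableP [set: nat])
    (fun n _ => finite_set_countable (finite_incident net (vs n)))).
  apply: subset_card_le => e _; have [n vn] := vs_surj (src e).
  by exists n => //; rewrite vn; left.
set y := yv P X rho.
have y_ge0 := height_ge0 P X rho; have y_rho := height_root rw vs_surj rho.
(* Some rectangle must cover a point at height [1 / 2]. *)
have y_pos : exists v, 0 < y v.
  have : [set p : R * R | 0 <= p.2 < 1] (0, 2^-1).
    by apply/andP; split => /=; lra.
  rewrite -rect_cover => -[e _ [_ /andP[_ /= yhi]]].
  have : 0 < Num.max (y (src e)) (y (tgt e)) by apply: lt_le_trans yhi.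
  by rewrite lt_max => /orP[]; [exists (src e)|exists (tgt e)].
have eta_gt0 := eta_cyl_gt0 net inc_n0 rw vs_surj y_pos.
have ylt1 := y_lt1 rect_cover Ivert_arc.
have lengths : {ae P rho, forall w,
    (fun n => Ilength src tgt c P X rho a (X n w)) @ \oo --> 0%E}.
  by apply: filterS conv => w [].
have root_width : 0 < arc_width Ivert_arc rho.
  have [u [e re] yu] : exists2 u, nbrs src tgt rho u & 0 < y u.
    apply: contrapT => no; move: eta_gt0; rewrite /eta_cyl fsbig1 ?ltxx// => u ru.
    apply/eqP; rewrite mulf_eq0; apply/orP; right.
    by rewrite eq_le y_ge0 andbT leNgt; apply/negP => yu; apply: no; exists u.
  have [ylo yhi] := joins_heights P X rho re.
  apply: (@arc_width_gt0 _ _ _ _ _ _ _ _ _ _ _ _ Ivert_arc eta_gt0 rho e).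
    apply/out_edgesE; split; first by case: re => -[]; [left|right].
    by rewrite ylo y_rho min_l.
  by rewrite len_gt0// ylo yhi y_rho min_l// lt_max yu orbT.
(* Transience comes from the hypothesis: each return to [rho] would bring back the positive width of
   its arc. *)
have leaves_root : {ae P rho, forall w, exists N, forall n, (N <= n)%N -> X n w <> rho}.
  apply: filterS lengths => w wl.
  have w4 : 0 < arc_width Ivert_arc rho / 4 by rewrite divr_gt0.
  have /fine_cvgP[[N1 _ h1] /cvgr_lt/(_ _ w4)[N2 _ h2]] := wl.
  exists (maxn N1 N2) => n; rewrite geq_max => /andP[n1 n2] Xn.
  have := Ilength_ge Ivert_arc eta_gt0 (X n w); have := h2 _ n2; have := h1 _ n1 => /= fn.
  by rewrite -(fineK fn) lee_fin Xn; lra.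
have heights := height_cvg1 net inc_n0 rw vs_surj leaves_root.
pose f := boundary_value Ivert_arc h M.
pose La : path_space rho -> R := limit_angle src tgt c P X theta.
have mLa : measurable_fun setT La := measurable_limit_angle src tgt c P X vs_surj theta.
have mf : measurable_fun setT f := measurable_boundary_value Ivert_arc hM.
pose A : set (path_space rho) := convergent_paths src tgt c P X theta `&`
  [set z | h (z n) @[n --> \oo] --> f (La z)].
have mA : measurable A.
  apply: measurableI; first exact: measurable_convergent_paths vs_surj _.
  apply: measurable_cvg_set; last exact: measurableT_comp.
  by move=> n _ Y mY; rewrite setTI; exact: (measurable_coord rho vs_surj n (h @^-1` Y)).
have A_shift z : A z -> A (pshift 1 z).
  move=> [zc zh]; have zL := circ_conv_limit_angle zc.
  have zL' := circ_conv_pshift zL; have zc' := circ_conv_convergent eta_gt0 zL'.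
  split; first exact: zc'.
  have [k kL] := circ_conv_unique eta_gt0 zL' (circ_conv_limit_angle zc').
  (* The shift may change the chosen lift of the limit by a multiple of [eta], which the periodic
     [f] does not see. *)
  rewrite /= /La kL /f boundary_value_int_period /pshift.
  rewrite (_ : (fun n => _) = [sequence h (z (n + 1)%N)]_n).
    by rewrite (cvg_shiftn 1 (fun n => h (z n))).
  by apply/funext => n; rewrite addnC.
have noext : {ae P rho, forall w m k n,
    ~ circ_conv src tgt c P X rho (fun i => theta (X i w))
      (sup (ray_ends Ivert_arc h m (rat_seq R k) (vs n))) /\
    ~ circ_conv src tgt c P X rho (fun i => theta (X i w))
      (inf (ray_ends Ivert_arc h m (rat_seq R k) (vs n)))}.
  apply: ae_foralln => m; apply: ae_foralln => k; apply: ae_foralln => n.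
  have atom := no_atoms net inc_n0 rw vs_surj rect_disj Ivert_arc Ivert_in eta_gt0 ylt1
    heights lengths theta_in.
  by apply: filterS2 (atom _) (atom _) => w h1 h2; split; [exact: h1|exact: h2].
have Arho : {ae P rho, forall w, A (trajectory X rho w)}.
  have start : {ae P rho, forall w, X 0 w = rho /\ forall n, nbrs src tgt (X n w) (X n.+1 w)}.
    by apply: filterS2 (ae_start rw vs_surj rho rho) (ae_nbrs net inc_n0 rw vs_surj rho rho).
  have hcvg := harmonic_cvg net inc_n0 rw vs_surj rho rho hh hM.
  have noext_cvg : {ae P rho, forall w, cvgn (fun n => h (X n w)) /\ (forall m k n,
      ~ circ_conv src tgt c P X rho (fun i => theta (X i w))
        (sup (ray_ends Ivert_arc h m (rat_seq R k) (vs n))) /\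
      ~ circ_conv src tgt c P X rho (fun i => theta (X i w))
        (inf (ray_ends Ivert_arc h m (rat_seq R k) (vs n))))}.
    by apply: filterS2 hcvg noext.
  have conv_heights : {ae P rho, forall w,
      ((exists t, circ_conv src tgt c P X rho (fun n => theta (X n w)) t) /\
      (fun n => Ilength src tgt c P X rho a (X n w)) @ \oo --> 0%E) /\
      y (X n w) @[n --> \oo] --> (1 : R)}.
    by apply: filterS2 conv heights.
  apply: filterS3 conv_heights start noext_cvg => w [[[t wt] wlen] wy] [X0 Xn] [/cvg_ex[H wh] wno].
  have zc := circ_conv_convergent eta_gt0 wt.
  split; first exact: zc.
  rewrite /= (_ : f _ = H)//; apply: (boundary_value_lim c_gt0 rect_disj rect_cover Ivert_in
    eta_gt0 y_ge0 y_rho countable_edges theta_in vs_surj hM X0 Xn _ wlen wy wh wno).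
  exact: circ_conv_limit_angle zc.
have Aall v := ae_transfer net inc_n0 rw vs_surj mA A_shift Arho v.
exists f; split => //.
- by exists (M + 1) => x; exact: boundary_value_bound.
- by move=> x; exact: boundary_value_period.
exists (La \o trajectory X rho); split.
  by apply: measurableT_comp => //; exact: (measurable_trajectory rw).
move=> v; split.
  by apply: filterS (Aall v) => w [zc _]; exact: circ_conv_limit_angle zc.
have mfL : measurable_fun setT (fun w => (f (La (trajectory X rho w)))%:E).
  apply/measurable_EFinP; apply: (measurableT_comp mf).
  by apply: (measurableT_comp mLa); exact: (measurable_trajectory rw).
(* The mean of [h (X n w)] is [h v] for every [n]; its limit is the mean of [f] at the limit
   angle. *)
have [|||||_ _] := @dominated_convergence _ _ _ (P v) setT measurableT
  (fun n w => (h (X n w))%:E) (fun w => (f (La (trajectory X rho w)))%:E) (fun=> M%:E).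
- by move=> n; apply/measurable_EFinP; exact: (measurable_fun_X rw vs_surj).
- exact: mfL.
- apply: filterS (Aall v) => w [_ wh] _; apply: cvg_EFin; last exact: wh.
  exact: nearW.
- by apply: finite_measure_integrable_cst.
- by apply: aeW => w n _; rewrite lee_fin.
rewrite (_ : (fun n => _) = (fun=> (h v)%:E)).
  by move=> lim_h; rewrite -(cvg_lim (@ereal_hausdorff R) lim_h) lim_cst//; exact: ereal_hausdorff.
apply/funext => n; rewrite (expectation_X net inc_n0 rw vs_surj).
by rewrite (isteps_harmonic _ _ hh).
Qed.
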